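(* Let $A$ be an artin algebra. Then $A$ is right-strongly (resp. left-strongly) quasi-hereditary if and only if there exists a heredity chain $$A=H_{0}>H_{1}> \cdots > H_i > \cdots >H_{n}=0$$ of $A$ such that $H_i$ is a projective right (resp. left) $A$-module for any $0 \leq i \leq n-1$.
   Context: All modules are finitely generated; $\mathrm{mod}\,A$ is the category of finitely generated right $A$-modules and $J(A)$ is the Jacobson radical of $A$. Heredity chains: a two-sided ideal $H$ of $A$ is called heredity if (a) $H^2=H$ (equivalently $H=AeA$ for some idempotent $e$); (b) $H$ is projective as a right $A$-module; (c) $HJ(A)H=0$. A chain of idempotent (two-sided) ideals $A=H_0>H_1>\cdots>H_n=0$ is a heredity chain if $H_i/H_{i+1}$ is a heredity ideal of $A/H_{i+1}$ for $0\le i\le n-1$. Right-strongly quasi-hereditary: let $\{S(i)\mid i\in I\}$ be a complete set of representatives of isomorphism classes of simple right $A$-modules, and $P(i)$ the projective cover of $S(i)$. Given a partial order $\le$ on $I$, the standard module $\Delta(i)$ is the maximal factor module of $P(i)$ all of whose composition factors have the form $S(j)$ with $j\le i$. $\mathcal F(\Delta)$ is the full subcategory of modules $M$ having a chain of submodules $M=M_0\supseteq M_1\supseteq\cdots\supseteq M_l=0$ whose successive quotients are each isomorphic to some standard module $\Delta(j)$; $(M:\Delta(j))$ denotes the number of quotients isomorphic to $\Delta(j)$ (filtration multiplicity). The pair $(A,\le)$ is right-strongly quasi-hereditary if for every $i\in I$ we have $[\Delta(i):S(i)]=1$ (composition multiplicity), and the kernel $K(i)$ in the short exact sequence $0\to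 K(i)\to P(i)\to\Delta(i)\to0$ satisfies: (a) $K(i)\in\mathcal F(\Delta)$; (b) if $(K(i):\Delta(j))\ne0$ then $i<j$; (c) $K(i)$ is a projective right $A$-module (equivalently, $\Delta(i)$ has projective dimension at most one). The pair $(A,\le)$ is left-strongly quasi-hereditary if $(A^{\mathrm{op}},\le)$ is right-strongly quasi-hereditary. $A$ is called right-strongly (resp. left-strongly) quasi-hereditary if $(A,\le)$ is so for some partial order $\le$ on $I$. *)

(* Defs.v *)
From HB Require Import structures.
From mathcomp Require Import all_boot all_algebra.
From mathcomp Require Import boolp.

Set Implicit Arguments.
Unset Strict Implicit.
Unset Printing Implicit Defensive.

Import GRing.Theory.
Local Open Scope ring_scope.
Local Open Scope quotient_scope.

(* A right A-module is an lmodType over the converse ring A^c; a left A-module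
   is an lmodType over A.  The notions on modules are stated once, for an
   lmodType over an arbitrary ring R.  Rings are pzRingType's because the
   quotient of a ring by an ideal may be zero.  Boolean predicates represent
   arbitrary subsets, by the classical axioms of boolp. *)

Record submodule (R : pzRingType) (M : lmodType R) := Submodule {
  submod_pred :> {pred M};
  submod_predP : submod_closed submod_pred
}.

HB.instance Definition _ (R : pzRingType) (M : lmodType R) (U : submodule M) :=
  GRing.isSubmodClosed.Build R M (submod_pred U)
    (GRing.submod_closed_semi (submod_predP U)).

Record submod_type (R : pzRingType) (M : lmodType R) (U : submodule M) :=
  SubmodType { submod_val : M; _ : submod_val \in U }.

Section SubmodType.
Variables (R : pzRingType) (M : lmodType R) (U : submodule M).
HB.instance Definition _ := [isSub for @submod_val R M U].
HB.instance Definition _ := [Choice of submod_type U by <:].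
HB.instance Definition _ := [SubChoice_isSubZmodule of submod_type U by <:].
HB.instance Definition _ := [SubZmodule_isSubLmodule of submod_type U by <:].
End SubmodType.

Definition quot_mod (R : pzRingType) (M : lmodType R) (U : submodule M) : Type :=
  Quotient.quot (submod_pred U).

Section QuotMod.
Variables (R : pzRingType) (M : lmodType R) (U : submodule M).

HB.instance Definition _ := GRing.Zmodule.on (quot_mod U).
HB.instance Definition _ : EqQuotient M (Quotient.equiv (submod_pred U)) (quot_mod U) :=
  EqQuotient.on (quot_mod U).
HB.instance Definition _ :
    isZmodQuotient M (Quotient.equiv (submod_pred U)) 0 -%R +%R (quot_mod U) :=
  ZmodQuotient.on (quot_mod U).

Definition quot_mod_scale (a : R) : quot_mod U -> quot_mod U :=
  lift_op1 (quot_mod U) ( *:%R a).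

Lemma pi_scale (a : R) :
  {morph \pi_(quot_mod U) : x / a *: x >-> quot_mod_scale a x}.
Proof.
move=> x; unlock quot_mod_scale; apply/eqP; rewrite piE Quotient.equivE.
rewrite -scalerBr rpredZ // Quotient.idealrBE.
by apply/eqP; rewrite reprK.
Qed.
Canonical pi_scale_morph (a : R) := PiMorph1 (pi_scale a).

Fact quot_mod_scalerA a b v :
  quot_mod_scale a (quot_mod_scale b v) = quot_mod_scale (a * b) v.
Proof. by rewrite -[v]reprK !piE scalerA. Qed.
Fact quot_mod_scale1r : left_id 1 quot_mod_scale.
Proof. by move=> v; rewrite -[v]reprK !piE scale1r. Qed.
Fact quot_mod_scalerDr : right_distributive quot_mod_scale +%R.
Proof. by move=> a u v; rewrite -[u]reprK -[v]reprK !piE scalerDr. Qed.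
Fact quot_mod_scalerDl v : {morph quot_mod_scale^~ v : a b / a + b}.
Proof. by move=> a b; rewrite -[v]reprK !piE scalerDl. Qed.

HB.instance Definition _ := GRing.Zmodule_isLmodule.Build R (quot_mod U)
  quot_mod_scalerA quot_mod_scale1r quot_mod_scalerDr quot_mod_scalerDl.

End QuotMod.

Section Subquotient.
Variables (R : pzRingType) (M : lmodType R) (U V : submodule M).

Definition restrict_pred : {pred submod_type U} := [pred x | \val x \in V].

Fact restrict_predP : submod_closed restrict_pred.
Proof.
split=> [|a x y]; first by rewrite inE raddf0 rpred0.
by rewrite !inE linearP => Vx Vy; rewrite rpredD // rpredZ.
Qed.

(* U / V, for V contained in U *)
Definition subquotient : Type := quot_mod (Submodule restrict_predP).
HB.instance Definition _ := GRing.Lmodule.on subquotient.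

End Subquotient.

Section Modules.
Variable R : pzRingType.
Implicit Types M N P T : lmodType R.

Definition lmod_iso M N : Prop := exists f : {linear M -> N}, bijective f.

Definition surjective_fun (X Y : Type) (f : X -> Y) : Prop :=
  forall y, exists x, f x = y.

Definition simple_module M : Prop :=
  (exists x : M, x != 0) /\
  forall U : submodule M, (forall x, x \in U -> x = 0) \/ (forall x, x \in U).

Definition projective P : Prop :=
  forall (M N : lmodType R) (g : {linear M -> N}) (f : {linear P -> N}),
    surjective_fun g -> exists h : {linear P -> M}, forall x, g (h x) = f x.

Definition superfluous M (U : M -> Prop) : Prop :=
  forall V : submodule M,
    (forall x, exists u v, [/\ U u, v \in V & x = u + v]) -> forall x, x \in V.

Definition projective_cover P M (p : {linear P -> M}) : Prop :=
  [/\ projective P, surjective_fun p & superfluous (fun x => p x = 0)].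

Definition artinian M : Prop :=
  forall U : nat -> submodule M, (forall n, {subset U n.+1 <= U n}) ->
    exists n, forall m, (n <= m)%N -> U m =i U n.

(* M = F 0 >= F 1 >= ... >= F l = 0 *)
Definition submodule_chain M (l : nat) (F : nat -> submodule M) : Prop :=
  [/\ forall x, x \in F 0%N,
      forall x, x \in F l -> x = 0
    & forall k, (k < l)%N -> {subset F k.+1 <= F k}].

Definition factor_count M (l : nat) (F : nat -> submodule M) T : nat :=
  #|[set k : 'I_l | `[< lmod_iso (subquotient (F k) (F k.+1)) T >]]|.

Definition composition_series M (l : nat) (F : nat -> submodule M) : Prop :=
  submodule_chain l F /\
  forall k, (k < l)%N -> simple_module (subquotient (F k) (F k.+1)).

Definition composition_factor M T : Prop :=
  exists l (F : nat -> submodule M),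
    composition_series l F /\
    exists2 k, (k < l)%N & lmod_iso (subquotient (F k) (F k.+1)) T.

(* [M : T] = m, as a relation; m is independent of the series (Jordan-Hoelder). *)
Definition composition_multiplicity M T (m : nat) : Prop :=
  exists l (F : nat -> submodule M),
    composition_series l F /\ factor_count l F T = m.

(* F(Delta) and (M : Delta j) = m, for a family Delta of modules *)

Definition filtration (I : Type) (Delta : I -> lmodType R) M (l : nat)
    (F : nat -> submodule M) : Prop :=
  submodule_chain l F /\
  forall k, (k < l)%N -> exists j, lmod_iso (subquotient (F k) (F k.+1)) (Delta j).

Definition filtered (I : Type) (Delta : I -> lmodType R) M : Prop :=
  exists l (F : nat -> submodule M), filtration Delta l F.

Definition filtration_multiplicity (I : Type) (Delta : I -> lmodType R) M
    (j : I) (m : nat) : Prop :=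
  exists l (F : nat -> submodule M),
    filtration Delta l F /\ factor_count l F (Delta j) = m.

(* A complete set of representatives S i of the isomorphism classes of simple
   modules, with their projective covers P i. *)
Record simple_system := SimpleSystem {
  idx : Type;
  simpleS : idx -> lmodType R;
  coverP : idx -> lmodType R;
  cover_map : forall i, {linear coverP i -> simpleS i};
  simpleS_simple : forall i, simple_module (simpleS i);
  simpleS_inj : forall i j, lmod_iso (simpleS i) (simpleS j) -> i = j;
  simpleS_complete : forall M, simple_module M -> exists i, lmod_iso M (simpleS i);
  cover_mapP : forall i, projective_cover (cover_map i)
}.

Definition partial_order (I : Type) (le : I -> I -> Prop) : Prop :=
  [/\ forall i, le i i,
      forall i j, le i j -> le j i -> i = j
    & forall i j k, le i j -> le j k -> le i k].

Section StronglyQuasiHereditary.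
Variables (D : simple_system) (le : idx D -> idx D -> Prop).

Definition factors_below (i : idx D) M : Prop :=
  forall T, composition_factor M T -> exists2 j, le j i & lmod_iso T (simpleS j).

(* P i / K is the largest factor module of P i satisfying factors_below i. *)
Definition standard_kernel (i : idx D) (K : submodule (coverP i)) : Prop :=
  factors_below i (quot_mod K) /\
  forall U : submodule (coverP i), factors_below i (quot_mod U) -> {subset K <= U}.

Definition strongly_quasi_hereditary_pair : Prop :=
  exists K : forall i, submodule (coverP i),
    let Delta i : lmodType R := quot_mod (K i) in
    (forall i, standard_kernel (K i)) /\
    forall i,
      [/\ composition_multiplicity (Delta i) (simpleS i) 1,
          filtered Delta (submod_type (K i)),
          forall j m, filtration_multiplicity Delta (submod_type (K i)) j m ->
            m <> 0%N -> le i j /\ i <> j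
        & projective (submod_type (K i))].

End StronglyQuasiHereditary.

Definition strongly_quasi_hereditary : Prop :=
  exists (D : simple_system) (le : idx D -> idx D -> Prop),
    partial_order le /\ strongly_quasi_hereditary_pair le.

End Modules.

Definition right_strongly_quasi_hereditary (A : pzRingType) : Prop :=
  strongly_quasi_hereditary A^c.

(* Right modules over the opposite algebra are left A-modules. *)
Definition left_strongly_quasi_hereditary (A : pzRingType) : Prop :=
  strongly_quasi_hereditary A.

Definition ideal_closed (A : pzRingType) (H : {pred A}) : Prop :=
  [/\ 0 \in H,
      {in H &, forall x y, x + y \in H},
      forall a, {in H, forall x, a * x \in H}
    & forall a, {in H, forall x, x * a \in H}].

Record ideal (A : pzRingType) := Ideal {
  ideal_pred :> {pred A};
  ideal_predP : ideal_closed ideal_pred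
}.

Section IdealModules.
Variables (A : pzRingType) (H : ideal A).

Fact ideal_left_closed : submod_closed (ideal_pred H : {pred A^o}).
Proof.
case: (ideal_predP H) => H0 HD Hl Hr.
by split=> // a x y Hx Hy; apply: HD => //; apply: Hl.
Qed.
Fact ideal_right_closed : submod_closed (ideal_pred H : {pred A^c^o}).
Proof.
case: (ideal_predP H) => H0 HD Hl Hr.
by split=> // a x y Hx Hy; apply: HD => //; apply: Hr.
Qed.
Fact ideal_zmod_closed : zmod_closed (ideal_pred H).
Proof.
case: (ideal_predP H) => H0 HD Hl Hr.
by split=> // x y Hx Hy; apply: HD => //; rewrite -mulN1r; apply: Hl.
Qed.
HB.instance Definition _ :=
  GRing.isZmodClosed.Build A (ideal_pred H) ideal_zmod_closed.

Definition ideal_as_left : submodule A^o := Submodule ideal_left_closed.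
Definition ideal_as_right : submodule A^c^o := Submodule ideal_right_closed.

Definition quot_ring : Type := Quotient.quot (ideal_pred H).

HB.instance Definition _ := GRing.Zmodule.on quot_ring.
HB.instance Definition _ : EqQuotient A (Quotient.equiv (ideal_pred H)) quot_ring :=
  EqQuotient.on quot_ring.
HB.instance Definition _ :
    isZmodQuotient A (Quotient.equiv (ideal_pred H)) 0 -%R +%R quot_ring :=
  ZmodQuotient.on quot_ring.

Definition quot_one : quot_ring := lift_cst quot_ring 1.
Definition quot_mul : quot_ring -> quot_ring -> quot_ring :=
  lift_op2 quot_ring *%R.
Canonical pi_quot_one_morph := PiConst quot_one.

Lemma pi_quot_mul : {morph \pi_quot_ring : x y / x * y >-> quot_mul x y}.
Proof.
move=> x y; unlock quot_mul; apply/eqP; rewrite piE Quotient.equivE.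
case: (ideal_predP H) => _ HD Hl Hr.
rewrite -[_ * _](addrNK (x * repr (\pi_quot_ring y))) -mulrBr -addrA -mulrBl.
apply: HD; [apply: Hl | apply: Hr];
  by rewrite Quotient.idealrBE; apply/eqP; rewrite reprK.
Qed.
Canonical pi_quot_mul_morph := PiMorph2 pi_quot_mul.

Fact quot_mulA : associative quot_mul.
Proof. by move=> x y z; rewrite -[x]reprK -[y]reprK -[z]reprK !piE mulrA. Qed.
Fact quot_mul1r : left_id quot_one quot_mul.
Proof. by move=> x; rewrite -[x]reprK !piE mul1r. Qed.
Fact quot_mulr1 : right_id quot_one quot_mul.
Proof. by move=> x; rewrite -[x]reprK !piE mulr1. Qed.
Fact quot_mulDl : left_distributive quot_mul +%R.
Proof. by move=> x y z; rewrite -[x]reprK -[y]reprK -[z]reprK !piE mulrDl. Qed.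
Fact quot_mulDr : right_distributive quot_mul +%R.
Proof. by move=> x y z; rewrite -[x]reprK -[y]reprK -[z]reprK !piE mulrDr. Qed.

HB.instance Definition _ := GRing.Zmodule_isPzRing.Build quot_ring
  quot_mulA quot_mul1r quot_mulr1 quot_mulDl quot_mulDr.

End IdealModules.

Section QuotientIdeal.
Variables (A : pzRingType) (H I : ideal A).

Definition quot_ideal_pred : {pred quot_ring I} :=
  fun y => `[< exists2 x, x \in H & \pi_(quot_ring I) x = y >].

Fact quot_ideal_predP : ideal_closed quot_ideal_pred.
Proof.
case: (ideal_predP H) => H0 HD Hl Hr; split.
- by apply/asboolP; exists 0; rewrite ?raddf0.
- move=> _ _ /asboolP[x Hx <-] /asboolP[y Hy <-].
  by apply/asboolP; exists (x + y); [apply: HD | rewrite piE].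
- move=> a _ /asboolP[x Hx <-]; apply/asboolP; exists (repr a * x); first exact: Hl.
  by rewrite pi_quot_mul reprK.
- move=> a _ /asboolP[x Hx <-]; apply/asboolP; exists (x * repr a); first exact: Hr.
  by rewrite pi_quot_mul reprK.
Qed.

(* H / I as an ideal of A / I *)
Definition quot_ideal : ideal (quot_ring I) := Ideal quot_ideal_predP.

End QuotientIdeal.

Section Heredity.
Variable A : pzRingType.

(* H ^ 2 = H *)
Definition idempotent_ideal (H : ideal A) : Prop :=
  forall x, x \in H <->
    exists n (u v : 'I_n -> A),
      (forall k, u k \in H /\ v k \in H) /\ x = \sum_(k < n) u k * v k.

Definition maximal_submodule (R : pzRingType) (M : lmodType R)
    (U : submodule M) : Prop :=
  (exists x, x \notin U) /\
  forall V : submodule M, {subset U <= V} -> V =i U \/ (forall x, x \in V).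

Definition jacobson_radical (x : A) : Prop :=
  forall U : submodule A^c^o, maximal_submodule U -> (x : A^c^o) \in U.

Definition heredity_ideal (H : ideal A) : Prop :=
  [/\ idempotent_ideal H,
      projective (submod_type (ideal_as_right H))
    & forall x j y, x \in H -> jacobson_radical j -> y \in H -> x * j * y = 0].

End Heredity.

Definition heredity_chain (A : pzRingType) (n : nat) (H : nat -> ideal A) : Prop :=
  [/\ forall x, x \in H 0%N,
      forall x, x \in H n -> x = 0,
      forall i, (i < n)%N ->
        {subset H i.+1 <= H i} /\ (exists2 x, x \in H i & x \notin H i.+1),
      forall i, (i <= n)%N -> idempotent_ideal (H i)
    & forall i, (i < n)%N -> heredity_ideal (quot_ideal (H i) (H i.+1))].

(* The structure of algebra is given by a ring morphism f from k to the centre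
   of A (algType would exclude the zero algebra). *)
Definition artin_algebra (A : pzRingType) : Prop :=
  exists (k : comPzRingType) (f : {rmorphism k -> A}),
    [/\ artinian k^o,
        forall c a, f c * a = a * f c
      & exists n (g : 'I_n -> A),
          forall a, exists c : 'I_n -> k, a = \sum_(i < n) f (c i) * g i].

(* Main.v *)
Require Import Defs.
From HB Require Import structures.
From mathcomp Require Import all_boot all_algebra.
From mathcomp Require Import boolp classical_sets.

(* Work with left modules over R, where R is A or its converse; R has finite length
   because an artinian commutative ring has.

   From a heredity chain (H_t) with projective terms, order the simple modules by the
   last t with H_t S <> 0, written l(S).  Then Delta(i) = P(i) / H_(l+1) P(i), and the
   kernel H_(l+1) P(i) is projective because P(i) is a summand of R.  A projective Q <> 0
   maps onto some P(i), and the kernel of Q -> Delta(i) is again projective and shorter,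
   so every projective of finite length is filtered by standard modules.

   Conversely, enumerate the simple modules along a linear extension of the order and
   let H_U be the trace in R of the P(i), i in U, for the up-sets U of the enumeration.
   If i is not in U then H_U P(i) = H_U K(i), with K(i) projective and shorter than P(i):
   by induction on the length H_U Q is projective for every projective Q.  If i is
   maximal outside U then K(i) = H_U P(i), and [Delta(i) : S(i)] = 1 gives the condition
   on the radical.

   Heredity ideals are defined through right modules, so the left case also requires
   that a layer H_U' / H_U, U' = U + {i}, is projective on the other side.  With
   P(i) = R e, a minimal generating family (x_k) of R e over the division ring
   e (R / H_U) e is free, and the induction on projectives extends its freeness from
   R e to R: the layer is the direct sum of the x_k e (R / H_U). *)

Set Implicit Arguments.
Unset Strict Implicit.
Unset Printing Implicit Defensive.

Import GRing.Theory.
Local Open Scope ring_scope.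
Local Open Scope quotient_scope.

(** * Submodules and linear maps *)

Section LinearMaps.
Variable R : pzRingType.
Implicit Types M N P Q S T : lmodType R.

(** Idempotence of H is used through H (H N) = H N, valid for every submodule N of every module: H
    annihilates M as soon as it annihilates all factors of a finite filtration of M. In a heredity
    layer, the inclusion of H_l J H_l in H_(l+1), with l = l(S(i)), means that H_l annihilates the
    radical of Delta(i). Hence S(i) occurs once in Delta(i) and all other composition factors have
    smaller level. Distinct simple modules of equal level are left incomparable.

    The radical is defined by maximal right ideals, while R may be A or its converse. Each is
    compared with the Jacobson radical on both sides.

    In the left case the ground ring intervenes once more, beyond finite length: the generators of A
    over it generate R e over the corner ring because their coefficients commute with e. *)

Definition linear_pack M N (f : M -> N) (fL : linear f) : {linear M -> N} :=
  HB.pack f (GRing.isLinear.Build R M N _ f fL).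

Section MakeSubmodule.
Variables (M : lmodType R) (P : M -> Prop).
Hypotheses (P0 : P 0) (PZD : forall a x y, P x -> P y -> P (a *: x + y)).

Fact prop_submod_closed : submod_closed [pred x | `[< P x >]].
Proof.
split; first exact/asboolP.
by move=> a x y /asboolP Px /asboolP Py; apply/asboolP; apply: PZD.
Qed.

Definition prop_submodule : submodule M := Submodule prop_submod_closed.

Lemma prop_submoduleP x : reflect (P x) (x \in prop_submodule).
Proof. exact: asboolP. Qed.

End MakeSubmodule.

Definition full_submodule M : submodule M :=
  @prop_submodule M (fun=> True) I (fun _ _ _ _ _ => I).

Lemma in_full M (x : M) : x \in full_submodule M.
Proof. exact/prop_submoduleP. Qed.

Fact zero_closed M (a : R) (x y : M) : x = 0 -> y = 0 -> a *: x + y = 0.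
Proof. by move=> -> ->; rewrite scaler0 addr0. Qed.
Definition zero_submodule M : submodule M :=
  @prop_submodule M (fun x => x = 0) erefl (@zero_closed M).

Lemma zero_submoduleP M (x : M) : reflect (x = 0) (x \in zero_submodule M).
Proof. exact: prop_submoduleP. Qed.

Section Preimage.
Variables (M N : lmodType R) (f : {linear M -> N}).

Fact preim_closed0 (V : submodule N) : f 0 \in V.
Proof. by rewrite raddf0 rpred0. Qed.
Fact preim_closedP (V : submodule N) a x y :
  f x \in V -> f y \in V -> f (a *: x + y) \in V.
Proof. by move=> Vx Vy; rewrite linearP rpredD // rpredZ. Qed.
Definition preim_submodule (V : submodule N) : submodule M :=
  prop_submodule (preim_closed0 V) (@preim_closedP V).

Lemma preim_submoduleP (V : submodule N) x :
  reflect (is_true (f x \in V)) (x \in preim_submodule V).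
Proof. exact: prop_submoduleP. Qed.

Fact im_closed0 (U : submodule M) : exists2 x, x \in U & f x = 0.
Proof. by exists 0; rewrite ?rpred0 ?raddf0. Qed.
Fact im_closedP (U : submodule M) a x y :
  (exists2 u, u \in U & f u = x) -> (exists2 u, u \in U & f u = y) ->
  exists2 u, u \in U & f u = a *: x + y.
Proof.
move=> [u Uu <-] [v Uv <-]; exists (a *: u + v); last by rewrite linearP.
by rewrite rpredD // rpredZ.
Qed.
Definition im_submodule (U : submodule M) : submodule N :=
  prop_submodule (im_closed0 U) (@im_closedP U).

Lemma im_submoduleP (U : submodule M) y :
  reflect (exists2 x, x \in U & f x = y) (y \in im_submodule U).
Proof. exact: prop_submoduleP. Qed.

Lemma mem_im (U : submodule M) x : x \in U -> f x \in im_submodule U.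
Proof. by move=> Ux; apply/im_submoduleP; exists x. Qed.

Definition ker_submodule : submodule M := preim_submodule (zero_submodule N).

Lemma ker_submoduleP x : reflect (f x = 0) (x \in ker_submodule).
Proof.
by apply: (iffP (preim_submoduleP _ _)) => /zero_submoduleP.
Qed.

End Preimage.

Section Sum.
Variables (M : lmodType R) (U V : submodule M).

Definition add_pred (x : M) := exists u v, [/\ u \in U, v \in V & x = u + v].
Fact add_closed0 : add_pred 0.
Proof. by exists 0, 0; rewrite !rpred0 addr0. Qed.
Fact add_closedP a x y : add_pred x -> add_pred y -> add_pred (a *: x + y).
Proof.
move=> [u [v [Uu Vv ->]]] [u' [v' [Uu' Vv' ->]]].
exists (a *: u + u'), (a *: v + v').
by rewrite !rpredD ?rpredZ // scalerDr addrACA.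
Qed.
Definition add_submodule : submodule M := prop_submodule add_closed0 add_closedP.

Lemma add_submoduleP x : reflect (add_pred x) (x \in add_submodule).
Proof. exact: prop_submoduleP. Qed.

Lemma add_subl : {subset U <= add_submodule}.
Proof. by move=> x Ux; apply/add_submoduleP; exists x, 0; rewrite rpred0 addr0. Qed.
Lemma add_subr : {subset V <= add_submodule}.
Proof. by move=> x Ux; apply/add_submoduleP; exists 0, x; rewrite rpred0 add0r. Qed.

End Sum.

Section Cyclic.
Variables (M : lmodType R) (z : M).
Fact cyclic_closed0 : exists a : R, 0 = a *: z.
Proof. by exists 0; rewrite scale0r. Qed.
Fact cyclic_closedP (a : R) (x y : M) :
  (exists b : R, x = b *: z) -> (exists b : R, y = b *: z) ->
  exists b : R, a *: x + y = b *: z.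
Proof. by move=> [b ->] [c ->]; exists (a * b + c); rewrite scalerDl scalerA. Qed.
Definition cyclic_submodule : submodule M :=
  prop_submodule cyclic_closed0 cyclic_closedP.

Lemma cyclic_submoduleP x : reflect (exists a : R, x = a *: z) (x \in cyclic_submodule).
Proof. exact: prop_submoduleP. Qed.

Lemma mem_cyclic : z \in cyclic_submodule.
Proof. by apply/cyclic_submoduleP; exists 1; rewrite scale1r. Qed.
End Cyclic.

Section Span.
Variables (M : lmodType R) (G : M -> Prop).
(** Intersection of all submodules containing [G]. An induction on a span thus amounts to choosing a
    submodule [X] that expresses the desired property. *)
Definition span_pred (x : M) :=
  forall X : submodule M, (forall y, G y -> y \in X) -> x \in X.
Fact span_closed0 : span_pred 0.
Proof. by move=> X _; rewrite rpred0. Qed.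
Fact span_closedP a x y : span_pred x -> span_pred y -> span_pred (a *: x + y).
Proof. by move=> Gx Gy X GX; rewrite rpredD ?rpredZ ?Gx ?Gy. Qed.
Definition span_submodule : submodule M :=
  prop_submodule span_closed0 span_closedP.

Lemma mem_span x : G x -> x \in span_submodule.
Proof. by move=> Gx; apply/prop_submoduleP => X; apply. Qed.

Lemma span_min (X : submodule M) :
  (forall y, G y -> y \in X) -> {subset span_submodule <= X}.
Proof. by move=> GX x /prop_submoduleP; apply. Qed.
End Span.

Section Product.
Variables (M : lmodType R) (H : {pred R}) (N : submodule M).

Definition prod_submodule : submodule M :=
  span_submodule (fun y => exists h x, [/\ h \in H, x \in N & y = h *: x]).

Lemma mem_prod h x : h \in H -> x \in N -> h *: x \in prod_submodule.
Proof. by move=> Hh Nx; apply: mem_span; exists h, x. Qed.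

Lemma prod_min (X : submodule M) :
  (forall h x, h \in H -> x \in N -> h *: x \in X) ->
  {subset prod_submodule <= X}.
Proof. by move=> HX; apply: span_min => _ [h [x [Hh Nx ->]]]; apply: HX. Qed.

Lemma prod_sub : {subset prod_submodule <= N}.
Proof. by apply: prod_min => h x _ Nx; rewrite rpredZ. Qed.
End Product.

Lemma prodS M (H H' : {pred R}) (N N' : submodule M) :
  {subset H <= H'} -> {subset N <= N'} ->
  {subset prod_submodule H N <= prod_submodule H' N'}.
Proof. by move=> HH' NN'; apply: prod_min => h x /HH' Hh /NN'; apply: mem_prod. Qed.

Lemma prod_map M N (f : {linear M -> N}) (H : {pred R}) (U : submodule M)
    (V : submodule N) x :
  (forall u, u \in U -> f u \in V) ->
  x \in prod_submodule H U -> f x \in prod_submodule H V.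
Proof.
move=> UV Hx; apply/preim_submoduleP; move: x Hx.
apply: prod_min => h x Hh /UV Vx; apply/preim_submoduleP.
by rewrite linearZ mem_prod.
Qed.

Lemma prod_im M N (f : {linear M -> N}) (H : {pred R}) (U : submodule M)
    (V : submodule N) y :
  (forall v, v \in V -> exists2 u, u \in U & f u = v) ->
  y \in prod_submodule H V -> exists2 x, x \in prod_submodule H U & f x = y.
Proof.
move=> UV Hy; apply/im_submoduleP; move: y Hy.
apply: prod_min => h _ Hh /UV [u Uu <-]; rewrite -linearZ.
by apply: mem_im; apply: mem_prod.
Qed.

Definition incl M (U : submodule M) : {linear submod_type U -> M} := \val.

Lemma inclP M (U : submodule M) (x : submod_type U) : incl U x \in U.
Proof. exact: valP. Qed.

Lemma incl_inj M (U : submodule M) : injective (incl U).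
Proof. exact: val_inj. Qed.

Section Corestriction.
Variables (M N : lmodType R) (f : {linear M -> N}) (U : submodule N).
Hypothesis fU : forall x, f x \in U.
Definition corestr_fun (x : M) : submod_type U := SubmodType (fU x).
Fact corestr_linear : linear corestr_fun.
Proof. by move=> a x y; apply: val_inj; rewrite /= linearP. Qed.
Definition corestr : {linear M -> submod_type U} := linear_pack corestr_linear.
Lemma corestrE x : incl U (corestr x) = f x. Proof. by []. Qed.
End Corestriction.

Lemma incl_lift M (U : submodule M) x : x \in U -> exists u, incl U u = x.
Proof. by move=> Ux; exists (SubmodType Ux). Qed.

(** A product H V' with V' inside U is the same whether computed in M or in U; this transports
    idempotence in M back to the submodule. *)
Lemma prod_incl M (H : {pred R}) (U : submodule M) (u : submod_type U)
   (V : submodule (submod_type U)) (V' : submodule M) :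
  (forall v, v \in V' -> exists2 w, w \in V & incl U w = v) ->
  incl U u \in prod_submodule H V' -> u \in prod_submodule H V.
Proof. by move=> VV' /(prod_im VV')[w Hw /incl_inj <-]. Qed.

Section QuotPi.
Variables (M : lmodType R) (U : submodule M).
Fact quot_pi_linear : linear (\pi_(quot_mod U) : M -> quot_mod U).
Proof. by move=> a x y; rewrite !piE. Qed.
Definition quot_pi : {linear M -> quot_mod U} := linear_pack quot_pi_linear.

Lemma quot_pi_surj : surjective_fun quot_pi.
Proof. by move=> y; exists (repr y); apply: reprK. Qed.

Lemma quot_pi_eq0 x : quot_pi x = 0 <-> x \in U.
Proof.
rewrite -(raddf0 quot_pi) /= -[x in x \in U]subr0 Quotient.idealrBE.
by split=> [->|/eqP].
Qed.
End QuotPi.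

End LinearMaps.
#[global] Hint Resolve in_full : core.

(** * Isomorphisms, simple and projective modules *)

Lemma inj_surj_bijective (X Y : Type) (f : X -> Y) :
  injective f -> surjective_fun f -> bijective f.
Proof.
move=> f_inj f_surj; have [g gP] := choice f_surj.
by exists g => [x|y]; [apply: f_inj|]; rewrite gP.
Qed.

Lemma bijective_surj (X Y : Type) (f : X -> Y) : bijective f -> surjective_fun f.
Proof. by move=> [g _ gK] y; exists (g y). Qed.

Section Isomorphisms.
Variable R : pzRingType.
Implicit Types M N P Q S T : lmodType R.

Lemma lmod_iso_refl M : lmod_iso M M.
Proof. by exists (idfun : {linear M -> M}); exists idfun. Qed.

Lemma lmod_iso_sym M N : lmod_iso M N -> lmod_iso N M.
Proof.
move=> [f [g fK gK]]; exists (linear_pack (can2_linear fK gK)); by exists f.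
Qed.

Lemma lmod_iso_trans M N P : lmod_iso M N -> lmod_iso N P -> lmod_iso M P.
Proof. by move=> [f fB] [g gB]; exists (g \o f : {linear M -> P}); apply: bij_comp. Qed.

Section QuotLift.
Variables (M N : lmodType R) (U : submodule M) (g : {linear M -> N}).
Hypothesis gU : forall x, x \in U -> g x = 0.
Definition quot_lift_fun (y : quot_mod U) : N := g (repr y).
Lemma quot_lift_funE x : quot_lift_fun (quot_pi U x) = g x.
Proof.
apply/eqP; rewrite -subr_eq0 -raddfB; apply/eqP/gU/quot_pi_eq0.
by rewrite raddfB /= reprK subrr.
Qed.
Fact quot_lift_linear : linear quot_lift_fun.
Proof.
move=> a x y; have [u <-] := quot_pi_surj x; have [v <-] := quot_pi_surj y.
by rewrite -linearP !quot_lift_funE linearP.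
Qed.
Definition quot_lift : {linear quot_mod U -> N} := linear_pack quot_lift_linear.
Lemma quot_liftE x : quot_lift (quot_pi U x) = g x.
Proof. exact: quot_lift_funE. Qed.
End QuotLift.

Lemma quot_isoP M (U : submodule M) T :
  lmod_iso (quot_mod U) T <->
  exists2 g : {linear M -> T}, surjective_fun g & forall x, g x = 0 <-> x \in U.
Proof.
split=> [[f fB]|[g g_surj gP]].
  exists (f \o quot_pi U : {linear M -> T}).
    move=> y; have [z <-] := bijective_surj fB y.
    by have [x <-] := quot_pi_surj z; exists x.
  move=> x; rewrite -quot_pi_eq0; split=> [/= fx0|/= ->]; last by rewrite raddf0.
  by apply: (bij_inj fB); rewrite fx0 raddf0.
have gU x : x \in U -> g x = 0 by move/gP.
exists (quot_lift gU); apply: inj_surj_bijective.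
  apply: raddf_inj => y; have [x <-] := quot_pi_surj y.
  by rewrite /= (quot_lift_funE gU) => /gP/quot_pi_eq0.
by move=> y; have [x <-] := g_surj y; exists (quot_pi U x); apply: quot_liftE.
Qed.

Lemma subquot_isoP M (U V : submodule M) T :
  lmod_iso (subquotient U V) T <->
  exists2 g : {linear submod_type U -> T}, surjective_fun g &
    forall x, g x = 0 <-> incl U x \in V.
Proof. exact: quot_isoP. Qed.

Lemma subquot_map M (U V : submodule M) :
  exists2 g : {linear submod_type U -> subquotient U V}, surjective_fun g &
    forall x, g x = 0 <-> incl U x \in V.
Proof. exact/subquot_isoP/lmod_iso_refl. Qed.

Lemma simple_surj M T (f : {linear M -> T}) x :
  simple_module T -> f x <> 0 -> surjective_fun f.
Proof.
move=> [_ Ts] fx y; have [h|h] := Ts (im_submodule f (full_submodule M)).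
  by case: fx; apply: h; apply: mem_im; apply: in_full.
by have /im_submoduleP[z _ <-] := h y; exists z.
Qed.

Lemma simple_gen S (s t : S) : simple_module S -> s <> 0 -> exists a : R, t = a *: s.
Proof.
move=> [_ Ss] s0; have [h|h] := Ss (cyclic_submodule s); last exact/cyclic_submoduleP.
by case: s0; apply/h/mem_cyclic.
Qed.

Lemma simple_nz S : simple_module S -> exists x : S, x <> 0.
Proof. by move=> [[x /eqP x0] _]; exists x. Qed.

Lemma simple_iso M N : lmod_iso M N -> simple_module M -> simple_module N.
Proof.
move=> [f fB] [[x x0] Ms]; have f_inj := bij_inj fB; split.
  exists (f x); apply: contra_neq x0 => fx0.
  by apply: f_inj; rewrite fx0 raddf0.
move=> U; have [h|h] := Ms (preim_submodule f U); [left|right] => y.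
  have [z <-] := bijective_surj fB y => Uz.
  by rewrite [z]h ?raddf0 //; apply/preim_submoduleP.
by have [z <-] := bijective_surj fB y; apply/preim_submoduleP.
Qed.

Lemma schur S T (f : {linear S -> T}) x :
  simple_module S -> simple_module T -> f x <> 0 -> lmod_iso S T.
Proof.
move=> Ss Ts fx; exists f; apply: inj_surj_bijective; last exact: simple_surj fx.
apply: raddf_inj => y fy; have [h|h] := Ss.2 (ker_submodule f).
  by apply: h; apply/ker_submoduleP.
by case: fx; apply/ker_submoduleP.
Qed.

Lemma subquot_simpleP M (U V : submodule M) :
  {subset V <= U} ->
  simple_module (subquotient U V) <->
  (exists2 x, x \in U & x \notin V) /\
  (forall W : submodule M, {subset V <= W} -> {subset W <= U} ->
     {subset W <= V} \/ {subset U <= W}).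
Proof.
move=> VU; have [g g_surj gP] := subquot_map U V; split.
  move=> [[y y0] Ss]; split.
    have [x gx] := g_surj y; exists (incl U x); first exact: inclP.
    apply/negP => Vx; case/eqP: y0; rewrite -gx; exact/gP.
  move=> W VW WU; have [h|h] := Ss (im_submodule g (preim_submodule (incl U) W)).
    left=> x Wx; have [u ux] := incl_lift (WU x Wx).
    rewrite -ux; apply/gP/h/mem_im/preim_submoduleP; by rewrite ux.
  right=> x /incl_lift [u <-]; have /im_submoduleP[v /preim_submoduleP Wv gv] := h (g u).
  have : g (u - v) = 0 by rewrite linearB /= gv subrr.
  by move/gP/VW; rewrite raddfB => /rpredD/(_ Wv); rewrite subrK.
move=> [[x Ux Vx] Ws]; split.
  have [u ux] := incl_lift Ux; exists (g u); apply/eqP => /gP.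
  by rewrite ux (negbTE Vx).
move=> X; pose W := im_submodule (incl U) (preim_submodule g X).
have VW : {subset V <= W}.
  move=> y Vy; have [u uy] := incl_lift (VU y Vy).
  rewrite -uy; apply/mem_im/preim_submoduleP.
  by have -> : g u = 0 by [apply/gP; rewrite uy]; rewrite rpred0.
have WU : {subset W <= U} by move=> y /im_submoduleP[u _ <-]; apply: inclP.
have [h|h] := Ws W VW WU; [left|right] => y; have [u <-] := g_surj y.
  by move=> Xu; apply/gP/h/mem_im/preim_submoduleP.
have /im_submoduleP[v /preim_submoduleP Xv /incl_inj <-//] := h _ (inclP u).
Qed.

Lemma quot_simpleP M (U : submodule M) :
  simple_module (quot_mod U) <-> maximal_submodule U.
Proof.
split.
  move=> [[y y0] Ss]; split.
    have [x xy] := quot_pi_surj y; exists x; apply/negP => Ux.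
    by case/eqP: y0; rewrite -xy; apply/quot_pi_eq0.
  move=> V UV; have [h|h] := Ss (im_submodule (quot_pi U) V); [left|right] => x.
    apply/idP/idP => [Vx|/UV//].
    by apply/quot_pi_eq0/h/mem_im.
  have /im_submoduleP[v Vv /eqP] := h (quot_pi U x).
  rewrite -subr_eq0 -raddfB => /eqP/quot_pi_eq0/UV Vvx.
  by rewrite -[x](subKr v) rpredB.
move=> [[x Ux] Um]; split.
  by exists (quot_pi U x); apply/eqP => /quot_pi_eq0; rewrite (negbTE Ux).
move=> X; have [|h|h] := Um (preim_submodule (quot_pi U) X).
- move=> y Uy; apply/preim_submoduleP.
  by have -> : quot_pi U y = 0 by [apply/quot_pi_eq0]; rewrite rpred0.
- left=> y; have [u <-] := quot_pi_surj y => Xu.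
  by apply/quot_pi_eq0; rewrite -h; apply/preim_submoduleP.
- by right=> y; have [u <-] := quot_pi_surj y; apply/preim_submoduleP.
Qed.

Lemma subquot_simple_iso M (U V : submodule M) T (g : {linear submod_type U -> T}) u :
  simple_module (subquotient U V) -> simple_module T ->
  (forall x, incl U x \in V -> g x = 0) -> g u <> 0 -> lmod_iso (subquotient U V) T.
Proof.
move=> UVs Ts gV gu.
have gW x : x \in Submodule (@restrict_predP _ _ U V) -> g x = 0 by move=> Vx; apply: gV.
apply: (schur (f := quot_lift gW) (x := quot_pi _ u)) UVs Ts _.
by rewrite quot_liftE.
Qed.

Lemma projective_retract P Q (i : {linear Q -> P}) (r : {linear P -> Q}) :
  (forall x, r (i x) = x) -> projective P -> projective Q.
Proof.
move=> ri Pp M N g f g_surj.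
have [h hP] := Pp M N g (f \o r : {linear P -> N}) g_surj.
by exists (h \o i : {linear Q -> M}) => x /=; rewrite hP /= ri.
Qed.

(** The single identity makes X a retract of the direct sum of P and Q, which suffices to add the
    two lifts. *)
Lemma projective_sum P Q (X : lmodType R) (i1 : {linear P -> X}) (i2 : {linear Q -> X})
    (q1 : {linear X -> P}) (q2 : {linear X -> Q}) :
  (forall x, x = i1 (q1 x) + i2 (q2 x)) ->
  projective P -> projective Q -> projective X.
Proof.
move=> dec Pp Qp M N g f g_surj.
have [h1 h1P] := Pp M N g (f \o i1 : {linear P -> N}) g_surj.
have [h2 h2P] := Qp M N g (f \o i2 : {linear Q -> N}) g_surj.
exists ((h1 \o q1) \+ (h2 \o q2) : {linear X -> M}) => x /=.
by rewrite linearD h1P h2P /= -linearD -dec.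
Qed.

Lemma projective_eqmem M (U V : submodule M) :
  U =i V -> projective (submod_type U) -> projective (submod_type V).
Proof.
move=> UV; have VU (x : submod_type V) : incl V x \in U by rewrite UV inclP.
have UV' (x : submod_type U) : incl U x \in V by rewrite -UV inclP.
apply: (@projective_retract _ _ (corestr VU) (corestr UV')) => x.
by apply: incl_inj; rewrite !corestrE.
Qed.

Lemma projective_zero M : (forall x : M, x = 0) -> projective M.
Proof.
move=> M0 X Y g f _; exists (\0 : {linear M -> X}) => x /=.
by rewrite [x]M0 !raddf0.
Qed.

Fact scaler_linear M (m : M) : linear (fun a : R^o => (a : R) *: m).
Proof. by move=> a x y; rewrite scalerDl -scalerA. Qed.
Definition orbit_map M (m : M) : {linear R^o -> M} := linear_pack (scaler_linear m).

Lemma orbit_mapE M (m : M) (a : R) : orbit_map m a = a *: m. Proof. by []. Qed.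

Lemma orbit_map_eta M (f : {linear R^o -> M}) (a : R) : f a = a *: f 1.
Proof. by rewrite -linearZZ; congr (f _); apply/esym/mulr1. Qed.

Lemma projective_regular : projective R^o.
Proof.
move=> M N g f g_surj; have [m gm] := g_surj (f 1).
by exists (orbit_map m) => a; rewrite [RHS]orbit_map_eta -gm -linearZZ.
Qed.

Definition kills (H : {pred R}) M := forall h (x : M), h \in H -> h *: x = 0.

Lemma kills_iso H M N : lmod_iso M N -> kills H M -> kills H N.
Proof.
move=> [f fB] HM h y Hh; have [x <-] := bijective_surj fB y.
by rewrite -linearZZ HM // raddf0.
Qed.

Definition idem_on (H : {pred R}) := forall M (N : submodule M),
  {subset prod_submodule H N <= prod_submodule H (prod_submodule H N)}.

(** By idempotence H M = H (H M) = ..., and each further factor H moves one step down the chain, so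
    H M lies in [F l], which is zero. *)
Lemma kills_chain H M l (F : nat -> submodule M) : idem_on H ->
  submodule_chain l F ->
  (forall k h x, (k < l)%N -> h \in H -> x \in F k -> h *: x \in F k.+1) ->
  kills H M.
Proof.
move=> Hi [F0 Fl _] HF h x Hh; apply: Fl.
suff Hk k : (k <= l)%N -> {subset prod_submodule H (full_submodule M) <= F k}.
  by apply: (Hk l (leqnn l)); apply: mem_prod; rewrite ?in_full.
elim: k => [|k IH] kl y Hy; first exact: F0.
have := Hi _ _ _ Hy; apply: (prod_min (X := F k.+1)) => {h Hh} h z Hh Hz.
by apply: HF => //; apply: IH => //; apply: ltnW.
Qed.

Lemma kills_subquot H M (U V : submodule M) :
  kills H (subquotient U V) <-> (forall h x, h \in H -> x \in U -> h *: x \in V).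
Proof.
have [g g_surj gP] := subquot_map U V; split=> HM h x Hh.
  move=> /incl_lift [u <-]; rewrite -linearZZ; apply/gP.
  by rewrite linearZZ HM.
have [u <-] := g_surj x; rewrite -linearZZ; apply/gP; rewrite linearZZ.
exact/HM/inclP.
Qed.

End Isomorphisms.

(** * Bounded length *)

(** Every descending chain has at most n strict steps. Repetitions are allowed, so that images and
    preimages of a chain can be compared with it term by term. *)
Definition bounded_length (R : pzRingType) (M : lmodType R) (n : nat) : Prop :=
  forall m (F : nat -> submodule M), (forall k, {subset F k.+1 <= F k}) ->
    (\sum_(k < m) `[< ~ {subset F k <= F k.+1} >] <= n)%N.

Lemma iterated_choice (T : Type) (P : T -> Prop) (E : T -> T -> Prop) :
  (exists u, P u) -> (forall u, P u -> exists2 v, P v & E u v) ->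
  exists u : nat -> T, forall k, P (u k) /\ E (u k) (u k.+1).
Proof.
move=> [u0 Pu0] step.
have [s sP] : {s : {u | P u} -> {u | P u} & forall u, E (sval u) (sval (s u))}.
  apply: (@choice _ _ (fun u v => E (sval u) (sval v))) => -[u Pu] /=.
  have [v Pv Ev] := step u Pu.
  by exists (exist _ v Pv).
exists (fun k => sval (iter k s (exist _ u0 Pu0))) => k.
by split; [apply: (svalP (iter k s _)) | apply: sP].
Qed.

Lemma dcc_minimal (R : pzRingType) (M : lmodType R) (P : submodule M -> Prop) :
  artinian M -> (exists U, P U) ->
  exists2 U, P U & forall V, P V -> {subset V <= U} -> {subset U <= V}.
Proof.
move=> Ma exP; apply: contrapT => nomin.
have [|F FP] := @iterated_choice _ P
  (fun U V => {subset V <= U} /\ ~ {subset U <= V}) exP.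
  move=> U PU; apply: contrapT => noV; apply: nomin; exists U => // V PV VU.
  by apply: contrapT => nUV; apply: noV; exists V.
have [|n Fn] := Ma F; first by move=> n; have [_ []] := FP n.
have [_ [_]] := FP n; apply=> x; by rewrite (Fn n.+1).
Qed.

Section BoundedLength.
Variable R : pzRingType.
Implicit Types M N P Q S T : lmodType R.

Lemma bounded_length_dcc M n : bounded_length M n -> artinian M.
Proof.
move=> Mn F Fdec; apply: contrapT => nostat.
have Fle k m : (k <= m)%N -> {subset F m <= F k}.
  elim: m => [|m IH]; first by rewrite leqn0 => /eqP->.
  rewrite leq_eqVlt => /orP[/eqP->//|/IH{}IH x /Fdec]; exact: IH.
have next k : exists m, (k < m)%N /\ ~ {subset F k <= F m}.
  apply: contrapT => noM; apply: nostat; exists k => m km x.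
  apply/idP/idP => [|Fx]; first exact: Fle.
  case: (ltnP k m) => [lt_km|le_mk].
    by apply: contrapT => nFx; apply: noM; exists m; split=> // /(_ x Fx).
  exact: Fle Fx.
have [s sP] := choice next.
have := Mn n.+1 (fun k => F (iter k s 0%N)) _.
have -> : (\sum_(k < n.+1) `[< ~ {subset F (iter k s 0%N) <= F (iter k.+1 s 0%N)} >] = n.+1)%N.
  rewrite -[RHS]muln1 -[n.+1 in RHS]card_ord -sum_nat_const; apply: eq_bigr => k _.
  by rewrite asboolT //=; apply: (sP _).2.
rewrite ltnn => contra; suff: false by []; apply: contra => k; apply: Fle; exact/ltnW/(sP _).1.
Qed.

Lemma bounded_length_max M n (P : submodule M -> Prop) :
  bounded_length M n -> (exists U, P U) ->
  exists2 U, P U & forall V, P V -> {subset U <= V} -> {subset V <= U}.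
Proof.
move=> Mn exP; apply: contrapT => nomax.
have [|F FP] := @iterated_choice _ P
  (fun U V => {subset U <= V} /\ ~ {subset V <= U}) exP.
  move=> U PU; apply: contrapT => noV; apply: nomax; exists U => // V PV VU.
  by apply: contrapT => nUV; apply: noV; exists V.
(* The ascending chain is read backwards from its term n+1; truncated subtraction makes it constant
   afterwards, so the chain is defined at all indices. *)
have := Mn n.+1 (fun k => F (n.+1 - k)%N) _.
have -> : (\sum_(k < n.+1) `[< ~ {subset F (n.+1 - k) <= F (n.+1 - k.+1)} >] = n.+1)%N.
  rewrite -[RHS]muln1 -[n.+1 in RHS]card_ord -sum_nat_const; apply: eq_bigr => k _.
  rewrite asboolT //=; have [_ [_]] := FP (n.+1 - k.+1)%N.
  by rewrite -subSn // subSS.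
rewrite ltnn => contra; suff: false by []; apply: contra => k.
case: (ltnP k n.+1) => [lt_kn|le_nk].
  by have [_ []] := FP (n.+1 - k.+1)%N; rewrite -subSn // subSS.
by have -> : (n.+1 - k.+1 = n.+1 - k)%N by apply/eqP; rewrite subSS; move: (le_nk);
  rewrite -subn_eq0 => /eqP->; rewrite subn_eq0 ltnW.
Qed.

(** By the modular law, a step of a chain of M that is strict stays strict either in its preimage in
    N or in its image in T. *)
Lemma bounded_length_ext N M T (f : {linear N -> M}) (p : {linear M -> T}) a b :
  (forall x, p x = 0 -> exists y, f y = x) ->
  bounded_length N a -> bounded_length T b -> bounded_length M (a + b).
Proof.
move=> ex Na Tb m F Fdec.
apply: (@leq_trans
  (\sum_(k < m) (`[< ~ {subset preim_submodule f (F k) <= preim_submodule f (F k.+1)} >]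
   + `[< ~ {subset im_submodule p (F k) <= im_submodule p (F k.+1)} >])))%N; last first.
  rewrite big_split leq_add //.
    by apply: (Na m (fun k => preim_submodule f (F k))) => k x /preim_submoduleP/Fdec Fx;
      apply/preim_submoduleP.
  apply: (Tb m (fun k => im_submodule p (F k))) => k _ /im_submoduleP[x /Fdec Fx <-].
  exact: mem_im.
apply: leq_sum => k _; case: asboolP => //= nF.
case: asboolP => //= npre; case: asboolP => //= nim; case: nF => x Fx.
have := contrapT nim _ (mem_im p Fx) => /im_submoduleP[y Fy pxy].
have [|z zE] := ex (x - y); first by rewrite linearB pxy subrr.
have Fz : z \in preim_submodule f (F k).
  by apply/preim_submoduleP; rewrite zE rpredB // Fdec.
have /preim_submoduleP := contrapT npre z Fz.
by rewrite zE => /rpredD/(_ Fy); rewrite subrK.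
Qed.

Lemma bounded_length_inj_proper N M (f : {linear N -> M}) w n :
  injective f -> (forall y, f y <> w) ->
  bounded_length M n.+1 -> bounded_length N n.
Proof.
move=> f_inj fw Mn m F Fdec.
(* The whole of M is put above the images of the chain; this extra first step is strict because w is
   not in the image of f. *)
pose G k := if k is k'.+1 then im_submodule f (F k') else full_submodule M.
have Gdec k : {subset G k.+1 <= G k}.
  case: k => [|k] //= _ /im_submoduleP[x /Fdec Fx <-]; exact: mem_im.
have := Mn m.+1 G Gdec; rewrite big_ord_recl asboolT /=; last first.
  by move=> /(_ w (in_full w))/im_submoduleP[y _ /fw].
rewrite add1n ltnS; apply: leq_trans; apply: leq_sum => k _.
case: asboolP => //= nF; rewrite asboolT // => sG; apply: nF => x Fx.
by have /im_submoduleP[y Fy /f_inj <-] := sG _ (mem_im f Fx).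
Qed.

Lemma bounded_length_surj_proper M T (p : {linear M -> T}) w n :
  surjective_fun p -> p w = 0 -> w <> 0 ->
  bounded_length M n.+1 -> bounded_length T n.
Proof.
move=> p_surj pw w0 Mn m F Fdec.
(* The preimages of the first m+1 terms are followed by 0; this extra last step is strict because w
   is in the kernel of p. *)
pose G k := if (k <= m)%N then preim_submodule p (F k) else zero_submodule M.
have Gdec k : {subset G k.+1 <= G k}.
  rewrite /G; case: (ltnP k m) => [/ltnW->|le_mk].
    by move=> x /preim_submoduleP/Fdec Fx; apply/preim_submoduleP.
  by move=> x /zero_submoduleP->; rewrite rpred0.
have := Mn m.+1 G Gdec; rewrite big_ord_recr asboolT /=; last first.
  rewrite /G leqnn ltnn => /(_ w) wG; apply/w0/zero_submoduleP/wG/preim_submoduleP.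
  by rewrite pw rpred0.
rewrite addn1 ltnS; apply: leq_trans; apply: leq_sum => k _.
case: asboolP => //= nF; rewrite asboolT //= /G ltn_ord (ltnW (ltn_ord k)) => sG.
apply: nF => y; have [x <-] := p_surj y => Fx.
by apply/preim_submoduleP/sG/preim_submoduleP.
Qed.

Lemma bounded_length_surj M T (p : {linear M -> T}) n :
  surjective_fun p -> bounded_length M n -> bounded_length T n.
Proof.
move=> p_surj Mn m F Fdec.
apply: leq_trans (Mn m (fun k => preim_submodule p (F k)) _).
  apply: leq_sum => k _; case: asboolP => //= nF; rewrite asboolT //= => sG.
  apply: nF => y; have [x <-] := p_surj y => Fx.
  by apply/preim_submoduleP/sG/preim_submoduleP.
by move=> k x /preim_submoduleP/Fdec Fx; apply/preim_submoduleP.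
Qed.

Lemma bounded_length_inj N M (f : {linear N -> M}) n :
  injective f -> bounded_length M n -> bounded_length N n.
Proof.
move=> f_inj Mn m F Fdec.
apply: leq_trans (Mn m (fun k => im_submodule f (F k)) _).
  apply: leq_sum => k _; case: asboolP => //= nF; rewrite asboolT //= => sG.
  by apply: nF => x Fx; have /im_submoduleP[y Fy /f_inj <-] := sG _ (mem_im f Fx).
move=> k _ /im_submoduleP[x /Fdec Fx <-]; exact: mem_im.
Qed.

Lemma bounded_length0 M : bounded_length M 0 -> forall x : M, x = 0.
Proof.
move=> M0 x.
have := M0 1%N (fun k => if k is 0%N then full_submodule M else zero_submodule M).
rewrite big_ord1 /= => h; apply/zero_submoduleP; apply: contrapT => nx.
suff: (1 <= 0)%N by []; rewrite -[in X in (X <= _)%N](_ : nat_of_bool true = 1%N) //.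
rewrite -(asboolT (P := ~ {subset full_submodule M <= zero_submodule M})); last first.
  by move=> /(_ x (in_full x)).
by apply: h => -[|k] y.
Qed.

Lemma bounded_length_simple T : simple_module T -> bounded_length T 1.
Proof.
move=> [_ Ts] m F Fdec.
(* Stronger bound for the induction: no strict step is possible once the chain starts at 0. *)
suff: (\sum_(k < m) `[< ~ {subset F k <= F k.+1} >] <=
       `[< ~ {subset F 0%N <= zero_submodule T} >])%N.
  by move/leq_trans; apply; case: asboolP.
elim: m F Fdec => [|m IH] F Fdec; first by rewrite big_ord0.
have := IH (fun k => F k.+1) (fun k => Fdec k.+1).
rewrite big_ord_recl; set s := (X in (X <= _)%N -> _).
rewrite -[X in (_ + X <= _)%N]/s => IHs.
case: (asboolP (~ {subset F 0%N <= F 1%N})) => [nF|_].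
  move: IHs; rewrite asboolF; last first.
    case=> x F1x; apply/zero_submoduleP.
    by case: (Ts (F 1%N)) => h; [apply: h | case: nF].
  rewrite leqn0 => /eqP->; rewrite addn0 asboolT // => s0.
  by apply: nF => x /s0/zero_submoduleP->; rewrite rpred0.
rewrite add0n (leq_trans IHs) //.
case: asboolP => // n1; rewrite asboolT // => s0; apply: n1 => x /(Fdec 0%N); exact: s0.
Qed.

Lemma exists_maximal M n (V : submodule M) w : bounded_length M n -> w \notin V ->
  exists2 U, maximal_submodule U & {subset V <= U}.
Proof.
move=> Mn Vw.
have [|U [[x Ux] VU] Umax] := @bounded_length_max M n
  (fun U => (exists x, x \notin U) /\ {subset V <= U}) Mn.
  by exists V; split=> //; exists w.
exists U => //; split; first by exists x.
move=> W UW; case: (EM (forall x, x \in W)) => [|nW]; [by right|left=> y].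
apply/idP/idP => [Wy|]; last exact: UW.
apply: (Umax W) => //; split; last by move=> z /VU/UW.
by move/existsNP: nW => [z /negP Wz]; exists z.
Qed.

(* A surjective endomorphism with nonzero kernel would decrease the length
   bound of M indefinitely. *)
Lemma surj_endo_inj M n (g : {linear M -> M}) :
  bounded_length M n -> surjective_fun g -> injective g.
Proof.
move=> Mn g_surj; apply: raddf_inj => w gw; apply: contrapT => w0.
elim: n Mn => [/bounded_length0/(_ w)//|n IH Mn]; apply: IH.
exact: bounded_length_surj_proper gw w0 Mn.
Qed.

(** For an exact sequence 0 -> N -> M -> T -> 0, a chain of N is continued by M with T as new top
    factor. This is the inductive step for composition series and for filtrations by standard
    modules. *)
Lemma chain_cons N M T (f : {linear N -> M}) (p : {linear M -> T}) l
    (F : nat -> submodule N) :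
  injective f -> surjective_fun p -> (forall y, p (f y) = 0) ->
  (forall x, p x = 0 -> exists y, f y = x) -> submodule_chain l F ->
  exists G : nat -> submodule M,
    [/\ submodule_chain l.+1 G, G 1%N = im_submodule f (F 0%N),
        lmod_iso (subquotient (G 0%N) (G 1%N)) T
      & forall k, lmod_iso (subquotient (G k.+1) (G k.+2)) (subquotient (F k) (F k.+1))].
Proof.
move=> f_inj p_surj pf ex [F0 Fl Fdec].
pose G k := if k is k'.+1 then im_submodule f (F k') else full_submodule M.
exists G; split=> //.
- split=> //; first by move=> _ /im_submoduleP[x /Fl-> <-]; rewrite raddf0.
  move=> [|k] lt_kl y; first by rewrite in_full.
  by move=> /im_submoduleP[x Fx <-]; apply: mem_im; apply: (Fdec k lt_kl).
- apply/subquot_isoP; exists (p \o incl (G 0%N) : {linear _ -> T}).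
    by move=> y; have [x <-] := p_surj y; have [u <-] := incl_lift (in_full x); exists u.
  move=> x /=; split=> [/ex[y <-]|/im_submoduleP[y _ <-]//]; exact: mem_im.
- move=> k; apply: lmod_iso_sym; apply/subquot_isoP.
  have [g g_surj gP] := subquot_map (G k.+1) (G k.+2).
  have fG (u : submod_type (F k)) : (f \o incl (F k) : {linear _ -> _}) u \in G k.+1.
    exact/mem_im/inclP.
  exists (g \o corestr fG : {linear _ -> _}).
    move=> y; have [x <-] := g_surj y.
    have /im_submoduleP[z Fz zx] := inclP x; have [u uz] := incl_lift Fz.
    by exists u; congr (g _); apply: incl_inj; rewrite -zx -uz.
  move=> u; rewrite -[X in X <-> _]/(g (corestr fG u) = 0) gP corestrE /=.
  split=> [/im_submoduleP[z Fz /f_inj <-//]|Fu]; exact: mem_im.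
Qed.

Lemma chain_zero M : (forall x : M, x = 0) ->
  submodule_chain 0 (fun=> zero_submodule M).
Proof. by move=> M0; split=> // x; apply/zero_submoduleP. Qed.

Lemma composition_series_exists M n : bounded_length M n ->
  exists l (F : nat -> submodule M), composition_series l F.
Proof.
elim: n M => [|n IH] M Mn.
  exists 0%N, (fun=> zero_submodule M); split=> //.
  exact/chain_zero/bounded_length0.
case: (EM (forall x : M, x = 0)) => [M0|/existsNP[w w0]].
  by exists 0%N, (fun=> zero_submodule M); split=> //; apply/chain_zero.
have [|U Umax _] := @exists_maximal M n.+1 (zero_submodule M) w Mn.
  by apply/negP => /zero_submoduleP.
have [x Ux] := Umax.1.
have Un : bounded_length (submod_type U) n.
  apply: (@bounded_length_inj_proper _ _ (incl U) x) Mn; first exact: incl_inj.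
  by move=> y yx; move: Ux; rewrite -yx inclP.
have [l [F [Fc Fs]]] := IH _ Un.
have [G [Gc _ G0 GS]] : _ := chain_cons (@incl_inj _ _ U) (@quot_pi_surj _ _ U)
  (fun y => (quot_pi_eq0 U _).2 (inclP y))
  (fun x p0 => incl_lift ((quot_pi_eq0 U x).1 p0)) Fc.
exists l.+1, G; split=> // -[|k] lt_kl.
  by apply: (simple_iso (lmod_iso_sym G0)); apply/quot_simpleP.
exact/(simple_iso (lmod_iso_sym (GS k)))/Fs.
Qed.

End BoundedLength.

(** * Finite length of artin algebras *)

Lemma bounded_length_zero (R : pzRingType) (M : lmodType R) :
  (forall x : M, x = 0) -> bounded_length M 0.
Proof.
move=> M0 m F _; rewrite big1 // => k _.
by rewrite asboolF //; apply=> x _; rewrite [x]M0 rpred0.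
Qed.

Section ArtinianCommutative.
Variable k : comPzRingType.
Implicit Types I L W X : submodule k^o.

Lemma bounded_quot_sub I W : {subset W <= I} ->
  simple_module (subquotient I W) ->
  (exists d, bounded_length (quot_mod I) d) ->
  exists d, bounded_length (quot_mod W) d.
Proof.
move=> WI Ss [d Id].
have fW (u : submod_type I) : u \in @restrict_pred _ _ I W ->
    (quot_pi W \o incl I : {linear _ -> _}) u = 0 by move/quot_pi_eq0.
have pW x : x \in W -> quot_pi I x = 0 by move=> /WI/quot_pi_eq0.
exists (1 + d)%N.
apply: (@bounded_length_ext _ _ _ _
  (@quot_lift _ _ _ (Submodule (@restrict_predP _ _ I W)) _ fW) (quot_lift pW)) Id.
- move=> y; have [x <-] := quot_pi_surj y.
  rewrite quot_liftE => /quot_pi_eq0/incl_lift[u <-].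
  by exists (quot_pi _ u); rewrite quot_liftE.
- exact: bounded_length_simple.
Qed.

(* Zorn's lemma provides the hyperplane W / B of the vector space I / B. *)
Lemma exists_simple_factor (I B : submodule k^o) (v : k^o) (m : {pred k}) :
  {subset B <= I} -> v \in I -> v \notin B ->
  (forall y x, y \in m -> x \in I -> y * x \in B) ->
  (forall y, y \notin m -> exists c, 1 - c * y \in m) ->
  exists W, [/\ {subset W <= I}, v \notin W & simple_module (subquotient I W)].
Proof.
move=> BI Iv Bv mB minv.
(* The submodule W is A together with B, rather than A itself, so that the empty chain of sets is
   bounded by B. *)
pose good (A : set k) (W : submodule k^o) :=
  [/\ forall x, x \in W <-> A x \/ x \in B, {subset W <= I} & v \notin W].
have [|A [[W [WA WI Wv]] Amax]] := @Zorn_bigcup k [set A | exists W, good A W]%classic.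
  move=> F FP Ftot.
  pose P x := (\bigcup_(X in F) X)%classic x \/ x \in B.
  have P_in x y : P x -> P y ->
      exists W, [/\ x \in W, y \in W, {subset W <= I} & v \notin W] /\
          (forall z, z \in W -> P z).
    have one (X : set k) : F X -> exists W, [/\ {subset W <= I}, v \notin W,
        (forall z, X z -> z \in W), {subset B <= W} & forall z, z \in W -> P z].
      move=> FX; have [W [WX WI Wv]] := FP X FX; exists W; split=> //.
      - by move=> z Xz; apply/WX; left.
      - by move=> z Bz; apply/WX; right.
      - by move=> z /WX[Xz|Bz]; [left; exists X | right].
    have two (X Y : set k) : F X -> F Y -> X x -> Y y ->
        exists W, [/\ x \in W, y \in W, {subset W <= I} & v \notin W] /\
          (forall z, z \in W -> P z).
      move=> FX FY Xx Yy; case: (Ftot X Y FX FY) => XY.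
        have [W [? ? XW _ ?]] := one Y FY; exists W; split=> //.
        by split=> //; apply: XW => //; apply: XY.
      have [W [? ? XW _ ?]] := one X FX; exists W; split=> //.
      by split=> //; apply: XW => //; apply: XY.
    move=> [[X FX Xx]|Bx] [[Y FY Yy]|By].
    - exact: two Xx Yy.
    - have [W [? ? XW BW ?]] := one X FX; exists W; split=> //.
      by split=> //; [apply: XW | apply: BW].
    - have [W [? ? XW BW ?]] := one Y FY; exists W; split=> //.
      by split=> //; [apply: BW | apply: XW].
    - exists B; split=> // z Bz; by right.
  have P0 : P 0 by right; apply: (@rpred0 _ B).
  have PZD (a : k) (x y : k^o) : P x -> P y -> P (a *: x + y).
    move=> Px Py; have [W [[Wx Wy _ _] WP]] := P_in x y Px Py.
    by apply: WP; rewrite rpredD // rpredZ.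
  exists (prop_submodule P0 PZD); split.
  - by move=> x; apply: iff_sym; apply: rwP; apply: prop_submoduleP.
  - move=> x /prop_submoduleP Px.
    by have [W [[Wx _ WI _] _]] := P_in x x Px Px; apply: WI.
  - apply/negP => /(prop_submoduleP P0 PZD v) Pv.
    by have [W [[Wv _ _ nWv] _]] := P_in v v Pv Pv; rewrite Wv in nWv.
have BW : {subset B <= W} by move=> x Bx; apply/WA; right.
have Wmax X : {subset W <= X} -> {subset X <= I} -> v \notin X -> {subset X <= W}.
  move=> WX XI Xv; apply: contrapT => nXW.
  apply: (Amax (fun x => x \in X)).
    split=> [x Ax|XA]; first by apply/WX/WA; left.
    by apply: nXW => x Xx; apply/WA; left; apply: XA.
  exists X; split=> // x; split=> [|[//|/BW/WX//]]; by left.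
exists W; split=> //; apply/subquot_simpleP => //; split; first by exists v.
move=> X WX XI; case: (boolP (v \in X)) => [Xv|nXv]; [right|left]; last exact: Wmax.
move=> t It; case: (boolP (t \in W)) => [/WX//|nWt].
have : v \in add_submodule W (cyclic_submodule (t : k^o)).
  apply: contraT => nv; case/negP: nWt.
  apply: (Wmax (add_submodule W (cyclic_submodule (t : k^o)))) => //.
  - exact: add_subl.
  - move=> _ /add_submoduleP[w [_ [/WI Iw /cyclic_submoduleP[c ->] ->]]].
    by rewrite rpredD // rpredZ.
  - exact/add_subr/mem_cyclic.
move=> /add_submoduleP[w [_ [Ww /cyclic_submoduleP[c ->] vE]]].
(* If c were in m, then c t would be in B and v in W. So c is invertible modulo m, and t is
   recovered from v - w up to an element of m I. *)
have mc : c \notin m.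
  apply: contra Wv => mc; rewrite vE rpredD //; apply: BW; exact: mB.
have [c' c'P] := minv c mc.
have -> : t = c' * (v - w) + (1 - c' * c) * t.
  rewrite vE [w + _]addrC addrK mulrBl mul1r -mulrA -[c *: t]/(c * t).
  by rewrite addrC subrK.
apply: (@rpredD _ X); last exact/WX/BW/mB.
by apply: (@rpredZ _ _ X c'); rewrite rpredB // WX.
Qed.

(** Let I be minimal among the ideals with k / I of finite length, and suppose I <> 0. Take L
    minimal with L I <> 0, x in L with x I <> 0, and let m be the annihilator of x I. Minimality of
    L gives x in (y x) for every y outside m, so k / m is a field. Since x m I = 0 while x I <> 0,
    the vector space I / m I is nonzero; it has a simple factor I / W, and k / W has finite length,
    against the choice of I. *)
Lemma artinian_bounded_length : artinian k^o -> exists d, bounded_length k^o d.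
Proof.
move=> ka.
have [|I [d Id] Imin] := @dcc_minimal _ k^o
  (fun I => exists d, bounded_length (quot_mod I) d) ka.
  exists (full_submodule _), 0%N; apply: bounded_length_zero => y.
  by have [x <-] := quot_pi_surj y; apply/quot_pi_eq0/in_full.
suff I0 : forall x, x \in I -> x = 0.
  exists d; apply: (@bounded_length_inj _ _ _ (quot_pi I)) Id.
  by apply: raddf_inj => x /quot_pi_eq0/I0.
apply: contrapT => /existsNP[u nu].
have {nu} [Iu u0] : u \in I /\ u <> 0.
  by split; [apply: contraT => Iu; case: nu; rewrite (negbTE Iu) | move=> u0; apply: nu].
have [|L [x [i [Lx Ii xi0]]] Lmin] := @dcc_minimal _ k^o
  (fun L => exists x i : k, [/\ x \in L, i \in I & x * i <> 0]) ka.
  by exists (full_submodule _), 1, u; split; [exact: (in_full (1 : k^o)) | | rewrite mul1r].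
pose annP (y : k^o) := forall j : k, j \in I -> y * x * j = 0.
have ann0 : annP 0 by move=> j _; rewrite !mul0r.
have annZD (a : k) (y z : k^o) : annP y -> annP z -> annP (a *: y + z).
  move=> Ay Az j Ij; rewrite !mulrDl Az // addr0.
  by rewrite -[a *: y]/(a * y) -(mulrA a y x) -(mulrA a (y * x) j) Ay // mulr0.
pose m := prop_submodule ann0 annZD.
have mP (y : k) : reflect (annP y) (y \in m) by exact: (prop_submoduleP ann0 annZD y).
have minv (y : k) : y \notin m -> exists c, 1 - c * y \in m.
  move=> my; have [j Ij yxj] : exists2 j, j \in I & y * x * j <> 0.
    apply: contrapT => nj; case/negP: my; apply/mP => j Ij.
    by apply: contrapT => yxj; apply: nj; exists j.
  have /cyclic_submoduleP[c cE] : x \in cyclic_submodule (y * x : k^o).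
    apply: (Lmin (cyclic_submodule (y * x : k^o))) => //.
      by exists (y * x), j; split=> //; apply: mem_cyclic.
    by move=> _ /cyclic_submoduleP[c ->]; rewrite scalerA rpredZ.
  exists c; apply/mP => j' _.
  by rewrite mulrBl mul1r -mulrA -[c * _]/(c *: (y * x : k^o)) -cE subrr mul0r.
pose B := prod_submodule (m : {pred k}) I.
have [v Iv Bv] : exists2 v, v \in I & v \notin B.
  apply: contrapT => nv; apply: xi0.
  suff /ker_submoduleP ix0 : i \in ker_submodule (orbit_map (x : k^o)).
    by rewrite mulrC.
  have : i \in B by apply: contraT => Bi; case: nv; exists i.
  apply: prod_min => y j /mP my Ij; apply/ker_submoduleP.
  by rewrite orbit_mapE -[_ *: _]/(y * j * x) mulrAC my.
have [W [WI Wv Ws]] := exists_simple_factor (@prod_sub _ _ m I) Iv Bv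
  (fun y x my Ix => mem_prod my Ix) minv.
case/negP: Wv; apply: (Imin W) => //.
by apply: (bounded_quot_sub WI Ws); exists d.
Qed.

Lemma fg_bounded_length d n (M : lmodType k) (g : 'I_n -> M) :
  bounded_length k^o d ->
  (forall x, exists c : 'I_n -> k, x = \sum_(i < n) c i *: g i) ->
  bounded_length M (n * d).
Proof.
move=> kd; elim: n M g => [|n IH] M g gM.
  by apply: bounded_length_zero => x; have [c ->] := gM x; rewrite big_ord0.
pose U := cyclic_submodule (g ord0); rewrite mulSn.
apply: (@bounded_length_ext _ k^o M (quot_mod U) (orbit_map (g ord0)) (quot_pi U)) => //.
  by move=> x /quot_pi_eq0/cyclic_submoduleP[a ->]; exists a.
apply: (IH _ (fun i => quot_pi U (g (lift ord0 i)))) => y.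
have [x <-] := quot_pi_surj y; have [c ->] := gM x.
exists (fun i => c (lift ord0 i)); rewrite big_ord_recl linearD.
have -> : quot_pi U (c ord0 *: g ord0) = 0.
  by apply/quot_pi_eq0/cyclic_submoduleP; exists (c ord0).
by rewrite add0r linear_sum; apply: eq_bigr => i _; rewrite linearZZ.
Qed.

End ArtinianCommutative.

(** Only the ordered set of submodules matters for length, and f embeds one such set into another,
    possibly over a different ring. *)
Lemma bounded_length_transfer (R R' : pzRingType) (M : lmodType R) (N : lmodType R')
    (f : submodule M -> submodule N) n :
  (forall U V : submodule M, {subset U <= V} <-> {subset f U <= f V}) ->
  bounded_length N n -> bounded_length M n.
Proof.
move=> fP Nn m F Fdec; have := Nn m (f \o F) (fun k => (fP _ _).1 (Fdec k)).
apply: leq_trans; apply: leq_sum => k _; case: asboolP => // nF.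
by rewrite asboolT // => /fP.
Qed.

Definition restrict_scalars (k A : pzRingType) (f : {rmorphism k -> A})
  (M : lmodType A) : Type := M.

Section RestrictScalars.
Variables (k A : pzRingType) (f : {rmorphism k -> A}) (M : lmodType A).
HB.instance Definition _ := GRing.Zmodule.on (restrict_scalars f M).
Definition restrict_scale (c : k) (x : restrict_scalars f M) : restrict_scalars f M :=
  f c *: (x : M).
Fact restrict_scaleA a b v :
  restrict_scale a (restrict_scale b v) = restrict_scale (a * b) v.
Proof. by rewrite /restrict_scale rmorphM scalerA. Qed.
Fact restrict_scale1 : left_id 1 restrict_scale.
Proof. by move=> v; rewrite /restrict_scale rmorph1 scale1r. Qed.
Fact restrict_scaleDr : right_distributive restrict_scale +%R.
Proof. by move=> a u v; apply: scalerDr. Qed.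
Fact restrict_scaleDl v : {morph restrict_scale^~ v : a b / a + b}.
Proof. by move=> a b; rewrite /restrict_scale rmorphD scalerDl. Qed.
HB.instance Definition _ := GRing.Zmodule_isLmodule.Build k (restrict_scalars f M)
  restrict_scaleA restrict_scale1 restrict_scaleDr restrict_scaleDl.
End RestrictScalars.

(** Left ideals and right ideals of A are both submodules of A over the ground ring; for right
    ideals this uses that the image of f is central. *)
Lemma artin_algebra_bounded_length (A : pzRingType) : artin_algebra A ->
  (exists d, bounded_length A^o d) /\ (exists d, bounded_length A^c^o d).
Proof.
move=> [k [f [ka fC [n [g gA]]]]]; have [d kd] := artinian_bounded_length ka.
pose M : lmodType k := restrict_scalars f A^o.
have Md : bounded_length M (n * d).
  apply: (@fg_bounded_length k d n M g kd) => x.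
  by have [c ->] := gA x; exists c.
have closed (P : {pred A}) : 0 \in P ->
    (forall a x y, x \in P -> y \in P -> f a * x + y \in P) ->
    exists U : submodule M, forall x : A, (x \in U) = (x \in P).
  move=> P0 PZD.
  have Pc : submod_closed (P : {pred M}) by split.
  by exists (Submodule Pc).
split; exists (n * d)%N.
  have : forall U : submodule A^o, exists V : submodule M,
      forall x : A, (x \in V) = (x \in U).
    move=> U; apply: closed => [|a x y Ux Uy]; first exact: (@rpred0 _ U).
    by apply: (@rpredD _ U) => //; apply: (@rpredZ _ _ U).
  move=> /choice[h hP]; apply: (@bounded_length_transfer _ _ _ _ h) Md => U V.
  by split=> UV x; have := UV x; rewrite !hP.
have : forall U : submodule A^c^o, exists V : submodule M,
    forall x : A, (x \in V) = (x \in U).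
  move=> U; apply: closed => [|a x y Ux Uy]; first exact: (@rpred0 _ U).
  by apply: (@rpredD _ U) => //; rewrite fC; apply: (@rpredZ _ _ U).
move=> /choice[h hP]; apply: (@bounded_length_transfer _ _ _ _ h) Md => U V.
by split=> UV x; have := UV x; rewrite !hP.
Qed.

(** * Projective covers and ideals *)

Section ProjectiveCovers.
Variable R : pzRingType.
Implicit Types M N P Q S T : lmodType R.

Lemma cover_full P S (p : {linear P -> S}) (V : submodule P) v :
  simple_module S -> projective_cover p -> v \in V -> p v <> 0 ->
  forall x, x \in V.
Proof.
move=> Ss [_ p_surj psup] Vv pv; apply: psup => x.
have Vs : surjective_fun (p \o incl V : {linear _ -> _}).
  have [u uv] := incl_lift Vv; apply: (@simple_surj _ _ _ _ u Ss).
  by rewrite /= -[val u]/(incl V u) uv.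
have [u pu] := Vs (p x); exists (x - incl V u), (incl V u); split.
- by rewrite linearB -pu subrr.
- exact: inclP.
- by rewrite subrK.
Qed.

(** A lift to P of the map a |-> a s0 from R is onto, because its image is not in the kernel of p,
    and it splits since P is projective. With e = s (f 1) this identifies P with R e. *)
Lemma cover_split P S (p : {linear P -> S}) : simple_module S -> projective_cover p ->
  exists (f : {linear R^o -> P}) (s : {linear P -> R^o}), forall x, f (s x) = x.
Proof.
move=> Ss pc; have [s0 s0P] := simple_nz Ss; have [Pp p_surj _] := pc.
have [f fP] := projective_regular (orbit_map s0) p_surj.
have f_surj : surjective_fun f.
  move=> x; suff /im_submoduleP[a _ <-] : x \in im_submodule f (full_submodule _) by exists a.
  apply: (cover_full Ss pc (mem_im f (in_full (1 : R^o)))).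
  by rewrite fP orbit_mapE scale1r.
have [s sP] := Pp _ _ f (idfun : {linear P -> P}) f_surj.
by exists f, s.
Qed.

Lemma projective_cover_exists S d : bounded_length R^o d -> simple_module S ->
  exists (P : lmodType R) (p : {linear P -> S}), projective_cover p.
Proof.
move=> Rd Ss; have [s0 s0P] := simple_nz Ss.
pose p0 := orbit_map s0.
have p0_surj : surjective_fun p0.
  by apply: (@simple_surj _ _ _ p0 1 Ss); rewrite orbit_mapE scale1r.
have [|W W_surj Wmin] := @dcc_minimal _ R^o
    (fun W => forall y, exists2 x, x \in W & p0 x = y) (bounded_length_dcc Rd).
  by exists (full_submodule _) => y; have [x <-] := p0_surj y; exists x.
pose p : {linear submod_type W -> S} := p0 \o incl W.
have p_surj : surjective_fun p.
  by move=> y; have [x /incl_lift[u <-] <-] := W_surj y; exists u.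
have Wfull (V : submodule (submod_type W)) :
    (forall y, exists2 v, v \in V & p v = y) -> forall x, x \in V.
  move=> V_surj x.
  have /(_ _ (inclP x)) : {subset W <= im_submodule (incl W) V}.
    apply: Wmin => [y|_ /im_submoduleP[u _ <-]]; last exact: inclP.
    by have [v Vv <-] := V_surj y; exists (incl W v) => //; apply: mem_im.
  by move=> /im_submoduleP[v Vv /incl_inj <-].
exists (submod_type W), p; split=> //; last first.
  move=> V VP; apply: Wfull => y; have [x <-] := p_surj y.
  by have [u [v [pu Vv ->]]] := VP x; exists v; rewrite // linearD pu add0r.
have [f fP] := projective_regular p0 p_surj.
pose g : {linear submod_type W -> submod_type W} := f \o incl W.
have g_surj : surjective_fun g.
  move=> x; suff /im_submoduleP[y _ <-] : x \in im_submodule g (full_submodule _) by exists y.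
  apply: Wfull => y; have [z <-] := p_surj y; exists (g z); first exact: mem_im.
  exact: fP.
have g_inj : injective g.
  apply: (@surj_endo_inj _ _ d) g_surj.
  exact: bounded_length_inj (@incl_inj _ _ W) Rd.
have [g' gK g'K] := inj_surj_bijective g_inj g_surj.
pose h := linear_pack (can2_linear gK g'K).
apply: (@projective_retract _ R^o _ (incl W \o h : {linear _ -> _}) f) => [x|].
  exact: g'K.
exact: projective_regular.
Qed.

(** For s <> 0 in S take the last k with (F k) s <> 0: the map a |-> a s induces the isomorphism. *)
Lemma simple_iso_factor l (F : nat -> submodule R^o) S :
  composition_series l F -> simple_module S ->
  exists2 k, (k < l)%N & lmod_iso (subquotient (F k) (F k.+1)) S.
Proof.
move=> [[F0 Fl Fdec] Fs] Ss; have [s s0] := simple_nz Ss.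
pose nz k := exists2 a : R, a \in F k & a *: s <> 0.
have [k [lt_kl nzk nzk1]] : exists k, [/\ (k < l)%N, nz k & ~ nz k.+1].
  apply: contrapT => nok.
  suff nzall k : (k <= l)%N -> nz k by have [a /Fl->] := nzall l (leqnn l); rewrite scale0r.
  elim: k => [_|k IH lt_kl]; first by exists 1; [apply: F0 | rewrite scale1r].
  by apply: contrapT => nk; apply: nok; exists k; split=> //; apply/IH/ltnW.
exists k => //.
pose g : {linear submod_type (F k) -> S} := orbit_map s \o incl (F k).
have [a /incl_lift[u <-] us] := nzk.
apply: (subquot_simple_iso (g := g) (u := u) (Fs k lt_kl) Ss _ us) => x Fx.
by apply: contrapT => xs; apply: nzk1; exists (incl (F k) x).
Qed.

Lemma simple_system_exists d : bounded_length R^o d -> inhabited (simple_system R).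
Proof.
move=> Rd; have [l [F Fc]] := composition_series_exists Rd.
pose T (k : 'I_l) : lmodType R := subquotient (F k) (F k.+1).
(* Each isomorphism class is represented by the factor of least index in the series. *)
pose I := {k : 'I_l | `[< forall j : 'I_l, lmod_iso (T j) (T k) -> (k <= j)%N >]}.
have Ts (i : I) : simple_module (T (val i)) by apply: Fc.2.
have cov (i : I) : {P : lmodType R & {p : {linear P -> T (val i)} | projective_cover p}}.
  have [P ex] := cid (projective_cover_exists Rd (Ts i)).
  by exists P; apply: cid.
constructor.
apply: (@SimpleSystem R I (fun i => T (val i)) (fun i => projT1 (cov i))
   (fun i => sval (projT2 (cov i)))) => //.
- move=> i j ij; apply/val_inj/ord_inj/eqP; rewrite eqn_leq; apply/andP; split.
    by move: (svalP i) => /asboolP; apply; apply: lmod_iso_sym.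
  by move: (svalP j) => /asboolP; apply.
- move=> M Ms; have [k lt_kl kM] := simple_iso_factor Fc Ms.
  pose P j := `[< exists lt_jl : (j < l)%N, lmod_iso (T (Ordinal lt_jl)) M >].
  have exP : exists j, P j by exists k; apply/asboolP; exists lt_kl.
  have [j /asboolP[lt_jl jM] jmin] := ex_minnP exP.
  have jI : `[< forall i : 'I_l, lmod_iso (T i) (T (Ordinal lt_jl)) -> (j <= i)%N >].
    apply/asboolP => i ij; apply: jmin; apply/asboolP; exists (ltn_ord i).
    apply: lmod_iso_trans jM; case: i ij => i lt_il /=.
    by rewrite (bool_irrelevance lt_il (ltn_ord (Ordinal lt_il))).
  by exists (exist _ (Ordinal lt_jl) jI); apply: lmod_iso_sym.
- move=> i; exact: (svalP (projT2 (cov i))).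
Qed.

End ProjectiveCovers.

Section Ideals.
Variables (R : pzRingType) (H : ideal R).
Implicit Types M N P Q S T : lmodType R.

Lemma ideal_mull a x : x \in H -> a * x \in H.
Proof. by case: (ideal_predP H) => _ _ + _; apply. Qed.
Lemma ideal_mulr a x : x \in H -> x * a \in H.
Proof. by case: (ideal_predP H) => _ _ _; apply. Qed.

Lemma prod_regularP (x : R^o) :
  x \in prod_submodule H (full_submodule R^o) <-> x \in ideal_as_left H.
Proof.
split=> [|Hx].
  apply: (@prod_min _ R^o H _ (ideal_as_left H)) => h a Hh _; exact: ideal_mulr.
have := @mem_prod _ R^o H (full_submodule R^o) x 1 Hx (in_full _).
by rewrite -[_ *: _]/(x * 1) mulr1.
Qed.

Lemma idempotent_prod : idempotent_ideal H -> idem_on H.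
Proof.
move=> Hi M N; apply: prod_min => h x /Hi[n [u [v [uv ->]]]] Nx.
rewrite scaler_suml; apply: rpred_sum => k _; have [Hu Hv] := uv k.
by rewrite -scalerA; apply: mem_prod => //; apply: mem_prod.
Qed.

Lemma prod_cover_full P S (p : {linear P -> S}) :
  simple_module S -> projective_cover p -> ~ kills H S ->
  forall x, x \in prod_submodule H (full_submodule P).
Proof.
move=> Ss pc /existsNP[h /existsNP[s nhs]]; have [_ p_surj _] := pc.
have [x xs] := p_surj s.
have [Hh hs] : h \in H /\ h *: s <> 0.
  split; last by move=> hs; apply: nhs.
  by apply: contraT => nHh; case: nhs; rewrite (negbTE nHh).
apply: (cover_full Ss pc (v := h *: x)); first exact: mem_prod.
by rewrite linearZZ xs.
Qed.

Lemma projective_prod P Q (i : {linear Q -> P}) (r : {linear P -> Q}) :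
  (forall x, r (i x) = x) ->
  projective (submod_type (prod_submodule H (full_submodule P))) ->
  projective (submod_type (prod_submodule H (full_submodule Q))).
Proof.
move=> ri.
have iH (x : submod_type (prod_submodule H (full_submodule Q))) :
    (i \o incl _ : {linear _ -> _}) x \in prod_submodule H (full_submodule P).
  by apply: prod_map (inclP x).
have rH (x : submod_type (prod_submodule H (full_submodule P))) :
    (r \o incl _ : {linear _ -> _}) x \in prod_submodule H (full_submodule Q).
  by apply: prod_map (inclP x).
apply: (@projective_retract _ _ _ (corestr iH) (corestr rH)) => x.
apply: incl_inj; rewrite corestrE -[LHS]/(r (incl _ (corestr iH x))) corestrE.
exact: ri.
Qed.

End Ideals.

Section ProjectiveInduction.
Variables (R : pzRingType) (D : simple_system R).
Variable K : forall i : idx D, submodule (coverP i).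
Hypothesis Kker : forall i x, x \in K i -> cover_map i x = 0.
Implicit Types Q : lmodType R.

Definition delta_top i : {linear quot_mod (K i) -> simpleS i} := quot_lift (@Kker i).

Lemma delta_top_surj i : surjective_fun (delta_top i).
Proof.
move=> y; have [_ c_surj _] := cover_mapP i; have [x <-] := c_surj y.
by exists (quot_pi _ x); apply: quot_liftE.
Qed.

Lemma delta_top_full i (V : submodule (quot_mod (K i))) v :
  v \in V -> delta_top i v <> 0 -> forall y, y \in V.
Proof.
have [x <-] := quot_pi_surj v => Vx; rewrite quot_liftE => px y.
have [z <-] := quot_pi_surj y; apply/preim_submoduleP.
apply: (cover_full (simpleS_simple i) (cover_mapP i) (v := x)) px z.
exact/preim_submoduleP.
Qed.

Hypothesis Kproj : forall i, projective (submod_type (K i)).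

(** A simple factor module S(i) of Q exists by finite length; the lift Q -> P(i) of Q -> S(i) is
    onto since its image is not in the kernel of P(i) -> S(i), and it splits. *)
Lemma split_cover Q n : bounded_length Q n -> projective Q -> (exists x : Q, x <> 0) ->
  exists (i : idx D) (p : {linear Q -> coverP i}) (s : {linear coverP i -> Q}),
    forall x, p (s x) = x.
Proof.
move=> Qn Qp [w w0].
have [|U Um _] := @exists_maximal _ Q n (zero_submodule Q) w Qn.
  by apply/negP => /zero_submoduleP.
have [i Ui] := simpleS_complete D ((quot_simpleP U).2 Um).
have [a a_surj _] := (quot_isoP U _).1 Ui.
have ci := cover_mapP i; have [Pp c_surj _] := ci.
have [p pP] := Qp _ _ (cover_map i) a c_surj; exists i, p.
have [y y0] := simple_nz (simpleS_simple i); have [x xy] := a_surj y.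
have p_surj : surjective_fun p.
  move=> z; suff /im_submoduleP[t _ <-] : z \in im_submodule p (full_submodule _) by exists t.
  apply: (cover_full (simpleS_simple i) ci (mem_im p (in_full x))).
  by rewrite pP xy.
have [s sP] := Pp _ _ p (idfun : {linear coverP i -> coverP i}) p_surj.
by exists s.
Qed.

(* Both kernels, of Q -> P(i) and of Q -> P(i) / K(i), are projective and
   shorter than Q. *)
Lemma projective_ind (Phi : lmodType R -> Prop) :
  (forall Q, (forall x : Q, x = 0) -> Phi Q) ->
  (forall Q (i : idx D) (p : {linear Q -> coverP i}) (s : {linear coverP i -> Q}),
    (forall x, p (s x) = x) ->
    Phi (submod_type (ker_submodule p)) ->
    Phi (submod_type (preim_submodule p (K i))) -> Phi Q) ->
  forall n Q, projective Q -> bounded_length Q n -> Phi Q.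
Proof.
move=> Phi0 PhiS; elim=> [|n IH] Q Qp Qn; first exact/Phi0/bounded_length0.
case: (EM (forall x : Q, x = 0)) => [|/existsNP Qnz]; first exact: Phi0.
have [i [p [s ps]]] := split_cover Qn Qp Qnz.
have qker (x : Q) : (idfun \- (s \o p) : {linear Q -> Q}) x \in ker_submodule p.
  by apply/ker_submoduleP; rewrite /= linearB ps subrr.
have [y y0] := simple_nz (simpleS_simple i).
have [_ c_surj _] := cover_mapP i; have [z zy] := c_surj y.
have Kz : z \notin K i by apply/negP => /Kker; rewrite zy.
have kerK : {subset ker_submodule p <= preim_submodule p (K i)}.
  by move=> x /ker_submoduleP px; apply/preim_submoduleP; rewrite px rpred0.
have ker_proj : projective (submod_type (ker_submodule p)).
  apply: (@projective_retract _ Q _ (incl _) (corestr qker)) Qp => x.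
  apply: incl_inj; rewrite corestrE /= -[val x]/(incl _ x).
  by have /ker_submoduleP -> := inclP x; rewrite raddf0 subr0.
apply: (PhiS Q i p s ps); apply: IH => //.
- apply: (@bounded_length_inj_proper _ _ _ (incl _) (s z)) Qn; first exact: incl_inj.
  move=> x xz; have /ker_submoduleP := inclP x; rewrite xz ps => z0.
  by move: Kz; rewrite z0 rpred0.
- have sK (x : submod_type (K i)) :
      (s \o incl _ : {linear _ -> _}) x \in preim_submodule p (K i).
    by apply/preim_submoduleP; rewrite /= ps; apply: inclP.
  have kK (x : submod_type (ker_submodule p)) : incl _ x \in preim_submodule p (K i).
    exact/kerK/inclP.
  have pK (x : submod_type (preim_submodule p (K i))) :
      (p \o incl _ : {linear _ -> _}) x \in K i.
    by have /preim_submoduleP := inclP x.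
  (* The preimage of K(i) is the direct sum of s (K(i)) and the kernel of p. *)
  apply: (@projective_sum _ _ _ _ (corestr sK) (corestr kK) (corestr pK)
     (corestr qker \o incl _ : {linear _ -> _})) => // [x|]; last exact: Kproj.
  by apply: incl_inj; rewrite linearD !corestrE /= addrC subrK.
- apply: (@bounded_length_inj_proper _ _ _ (incl _) (s z)) Qn; first exact: incl_inj.
  move=> x xz; have /preim_submoduleP := inclP x; rewrite xz ps => Kz'.
  by rewrite Kz' in Kz.
Qed.

End ProjectiveInduction.

(** * From heredity chains to standard modules *)

Section ChainToStrong.
Variables (R : pzRingType) (d n : nat) (H : nat -> ideal R).
Hypothesis Rd : bounded_length R^o d.
Hypothesis H0 : forall x, x \in H 0%N.
Hypothesis Hn : forall x, x \in H n -> x = 0.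
Hypothesis HS : forall t, (t < n)%N -> {subset H t.+1 <= H t}.
Hypothesis Hidem : forall t, (t <= n)%N -> idempotent_ideal (H t).
Hypothesis Hproj : forall t, (t < n)%N -> projective (submod_type (ideal_as_left (H t))).
Hypothesis Hrad : forall t (N : submodule R^o), (t < n)%N ->
  superfluous (fun x => x \in N) -> forall x a y,
  x \in H t -> a \in N -> y \in H t -> x * a * y \in H t.+1.
Variable D : simple_system R.
Implicit Types i j : idx D.

Lemma chain_le t u : (t <= u <= n)%N -> {subset H u <= H t}.
Proof.
elim: u => [|u IH]; first by rewrite leqn0 => /andP[/eqP-> _].
move=> /andP[]; rewrite leq_eqVlt => /predU1P[->|lt_tu] lt_un x; first by [].
by move=> /(HS lt_un); apply: IH; rewrite -ltnS lt_tu ltnW.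
Qed.

Lemma chain_idem t : (t <= n)%N -> idem_on (H t).
Proof. by move=> /Hidem/idempotent_prod. Qed.

Lemma chain_projective t : (t <= n)%N ->
  projective (submod_type (prod_submodule (H t) (full_submodule R^o))).
Proof.
rewrite leq_eqVlt => /orP[/eqP->|/Hproj].
  apply: projective_zero => x; apply: incl_inj; rewrite raddf0.
  exact/Hn/prod_regularP/inclP.
by apply: projective_eqmem => x; apply/idP/idP => /prod_regularP.
Qed.

Lemma level_exists i : exists l, [/\ (l < n)%N,
  forall t, (t <= l)%N -> ~ kills (H t) (simpleS i)
  & forall t, (l < t <= n)%N -> kills (H t) (simpleS i)].
Proof.
have [s s0] := simple_nz (simpleS_simple i).
pose P t := (t <= n)%N && `[< ~ kills (H t) (simpleS i) >].
have exP : exists t, P t.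
  exists 0%N; apply/asboolP => /(_ 1 s (H0 1)); by rewrite scale1r.
have Pn t : P t -> (t <= n)%N by case/andP.
have [l /andP[le_ln /asboolP nkl] lmax] := ex_maxnP exP Pn; exists l; split.
- rewrite ltn_neqAle le_ln andbT; apply/eqP => ln; apply: nkl => h x.
  by rewrite ln => /Hn->; rewrite scale0r.
- move=> t le_tl kt; apply: nkl => h x Hh; apply: kt.
  by apply: chain_le Hh; rewrite le_tl.
- move=> t /andP[lt_lt le_tn]; apply: contrapT => nk.
  by have := lmax t; rewrite /P le_tn asboolT // leqNgt lt_lt => /(_ isT).
Qed.

Let level : idx D -> nat := projT1 (choice level_exists).
Let levelP i := projT2 (choice level_exists) i.

Lemma level_lt i : (level i < n)%N. Proof. by have [] := levelP i. Qed.

Lemma level_kills i t : (t <= n)%N -> kills (H t) (simpleS i) <-> (level i < t)%N.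
Proof.
move=> le_tn; have [_ nk k] := levelP i; split=> [kt|lt]; last by apply: k; rewrite lt.
by rewrite ltnNge; apply/negP => /nk.
Qed.

Let K i : submodule (coverP i) :=
  prod_submodule (H (level i).+1) (full_submodule (coverP i)).

Lemma K_ker i x : x \in K i -> cover_map i x = 0.
Proof.
move=> Kx; apply/ker_submoduleP; move: x Kx; apply: prod_min => h x Hh _.
apply/ker_submoduleP; rewrite linearZZ.
by apply: ((level_kills i (level_lt i)).2 (ltnSn _)).
Qed.

Lemma K_projective i : projective (submod_type (K i)).
Proof.
have [f [s fs]] := cover_split (simpleS_simple i) (cover_mapP i).
exact/(projective_prod fs)/chain_projective/level_lt.
Qed.

Lemma cover_bounded i : bounded_length (coverP i) d.
Proof.
have [f [s fs]] := cover_split (simpleS_simple i) (cover_mapP i).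
by apply: (@bounded_length_surj _ _ _ f) Rd => x; exists (s x).
Qed.

Lemma cover_prod_full i t x : (t <= level i)%N ->
  x \in prod_submodule (H t) (full_submodule (coverP i)).
Proof.
move=> tl; apply: (prod_cover_full (simpleS_simple i) (cover_mapP i)).
move=> /(level_kills i (leq_trans tl (ltnW (level_lt i)))).
by rewrite ltnNge tl.
Qed.

Lemma level_rad i h x : h \in H (level i) -> cover_map i x = 0 -> h *: x \in K i.
Proof.
move=> Hh px; have [f [s fs]] := cover_split (simpleS_simple i) (cover_mapP i).
pose N := im_submodule s (ker_submodule (cover_map i)).
have Nsup : superfluous (fun x => x \in N).
  move=> V VN; have [_ _ psup] := cover_mapP i.
  have sV : forall y, y \in preim_submodule s V.
    apply: psup => y; have [_ [v [/im_submoduleP[u /ker_submoduleP pu <-] Vv yE]]] := VN (s y).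
    exists u, (y - u); split=> //; last by rewrite addrC subrK.
    by apply/preim_submoduleP; rewrite linearB yE addrC addKr.
  move=> y; have [_ [v [/im_submoduleP[u _ <-] Vv ->]]] := VN y.
  by rewrite rpredD //; apply/preim_submoduleP.
have Nx : s x \in N by apply/mem_im/ker_submoduleP.
have He : s (f 1) \in H (level i).
  apply/prod_regularP; apply: (@prod_map _ _ _ s _ (full_submodule _)) => //.
  exact: cover_prod_full.
have := Hrad (level_lt i) Nsup Hh Nx He.
have -> : h * s x * s (f 1) = s (h *: x).
  rewrite linearZZ -mulrA; congr (h * _).
  by rewrite -[in RHS](fs x) (orbit_map_eta f (s x)) linearZZ.
by move=> Hhx; rewrite -[h *: x]fs orbit_map_eta; apply: mem_prod.
Qed.

Let Delta i : lmodType R := quot_mod (K i).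

Lemma Delta_kills i : kills (H (level i).+1) (Delta i).
Proof.
move=> h y Hh; have [x <-] := quot_pi_surj y; rewrite -linearZZ.
exact/quot_pi_eq0/mem_prod.
Qed.

Let top i : {linear Delta i -> simpleS i} := delta_top K_ker i.

Lemma top_ker_kills i h y : h \in H (level i) -> top i y = 0 -> h *: y = 0.
Proof.
have [x <-] := quot_pi_surj y => Hh; rewrite quot_liftE => px.
by rewrite -linearZZ; apply/quot_pi_eq0/level_rad.
Qed.

Let le i j : Prop := i = j \/ (level i < level j)%N.

Lemma le_partial_order : partial_order le.
Proof.
split=> [i|i j|i j k]; first by left.
  by case=> // lt_ij [//|]; rewrite ltnNge (ltnW lt_ij).
case=> [->//|lt_ij] [<-|lt_jk]; right=> //; exact: ltn_trans lt_jk.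
Qed.

Lemma le_level i j : le i j -> (level i <= level j)%N.
Proof. by case=> [->//|/ltnW]. Qed.

(** A composition factor S(j) of Delta(i) is annihilated by H_(l(i)+1), so l(j) <= l(i). In case of
    equality H_(l(i)) does not annihilate it, so it does not come from the kernel of Delta(i) ->
    S(i), and [top] yields j = i. Conversely, H_(l(i)+1) annihilates all simple modules below i,
    hence every factor module of P(i) built from them, which gives maximality. *)
Lemma Delta_standard i : standard_kernel le (K i).
Proof.
split.
  move=> T [l [F [[[F0 Fl Fdec] Fs] [k lt_kl FT]]]].
  have Fk := Fs k lt_kl; have [j Tj] := simpleS_complete D Fk.
  exists j; last exact/(lmod_iso_trans (lmod_iso_sym FT)).
  have lev_ji : (level j <= level i)%N.
    rewrite -ltnS; apply/level_kills; first exact: level_lt.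
    apply: (kills_iso Tj); apply/kills_subquot => h x Hh _.
    by rewrite Delta_kills // rpred0.
  move: lev_ji; rewrite leq_eqVlt => /orP[/eqP lev_ji|]; [left|by right].
  case: (EM (exists2 x, x \in F k & top i x <> 0)) => [[x Fx tx]|nx]; last first.
    have [] := levelP j => _ /(_ (level j) (leqnn _)) []; apply: (kills_iso Tj).
    apply/kills_subquot => h x Hh Fx; rewrite (@top_ker_kills i) ?rpred0 -?lev_ji //.
    by apply: contrapT => tx; apply: nx; exists x.
  have topk1 y : y \in F k.+1 -> top i y = 0.
    move=> Fy; apply: contrapT => /(delta_top_full Fy) Fall.
    have [[z _]] := (subquot_simpleP (Fdec k lt_kl)).1 Fk.
    by rewrite Fall.
  apply: (@simpleS_inj _ D); apply: lmod_iso_trans (lmod_iso_sym Tj) _.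
  have [u ux] := incl_lift Fx.
  apply: (@subquot_simple_iso _ _ _ _ _ (top i \o incl (F k) : {linear _ -> _}) u) => //.
  - exact: simpleS_simple.
  - by move=> y /topk1.
  - by move=> tu; apply: tx; rewrite -ux.
move=> U Ufac; apply: prod_min => h x Hh _.
have Ud : bounded_length (quot_mod U) d.
  apply: (@bounded_length_surj _ _ _ (quot_pi U)) (@cover_bounded i).
  exact: quot_pi_surj.
have [l [F Fc]] := composition_series_exists Ud; have [Fch Fs] := Fc.
apply/quot_pi_eq0; rewrite linearZZ.
apply: (kills_chain (chain_idem (level_lt i)) Fch) Hh => k {}h {}x lt_kl Hh.
have [j ji Tj] : exists2 j, le j i & lmod_iso (subquotient (F k) (F k.+1)) (simpleS j).
  apply: Ufac; exists l, F; split=> //; exists k => //; exact: lmod_iso_refl.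
move: h x Hh; apply/kills_subquot/(kills_iso (lmod_iso_sym Tj)).
by apply/level_kills; [apply: level_lt | rewrite ltnS le_level].
Qed.

(** Take a series with S(i) on top of a series of the kernel of Delta(i) -> S(i). That kernel is
    annihilated by H_(l(i)), and S(i) is not. *)
Lemma Delta_multiplicity i : composition_multiplicity (Delta i) (simpleS i) 1.
Proof.
have Dd : bounded_length (Delta i) d.
  apply: (@bounded_length_surj _ _ _ (quot_pi (K i))) (@cover_bounded i).
  exact: quot_pi_surj.
pose N := ker_submodule (top i).
have Nd : bounded_length (submod_type N) d.
  exact: bounded_length_inj (@incl_inj _ _ N) Dd.
have [l [F [Fch Fs]]] := composition_series_exists Nd.
have [G [Gch _ G0 GS]] := chain_cons (@incl_inj _ _ N) (@delta_top_surj _ _ _ K_ker i)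
  (fun y => ker_submoduleP (top i) _ (inclP y))
  (fun x tx => incl_lift (introT (ker_submoduleP (top i) _) tx)) Fch.
exists l.+1, G; split.
  split=> // -[|k] lt_kl.
    exact/(simple_iso (lmod_iso_sym G0))/simpleS_simple.
  exact/(simple_iso (lmod_iso_sym (GS k)))/Fs.
rewrite /factor_count (_ : [set k | _] = [set ord0]) ?cards1 //.
apply/setP => k; rewrite !inE; apply/asboolP/eqP => [Gk|->//].
case: k Gk => -[|k] lt_kl Gk; first exact/val_inj.
have [] := levelP i => _ /(_ (level i) (leqnn _)) [].
apply: (kills_iso Gk); apply: (kills_iso (lmod_iso_sym (GS k))).
apply/kills_subquot => h x Hh _.
suff -> : h *: x = 0 by rewrite rpred0.
apply: incl_inj; rewrite linearZZ raddf0; apply: top_ker_kills => //.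
exact/ker_submoduleP/inclP.
Qed.

Lemma projective_filtered m Q : projective Q -> bounded_length Q m -> filtered Delta Q.
Proof.
apply: (projective_ind K_ker K_projective) => {Q}.
  by move=> Q Q0; exists 0%N, (fun=> zero_submodule Q); split=> //; apply: chain_zero.
move=> Q i p s ps _ [l [F [Fch FD]]].
have p_surj : surjective_fun (quot_pi (K i) \o p : {linear _ -> _}).
  by move=> y; have [x <-] := quot_pi_surj y; exists (s x); rewrite /= ps.
have [|x /quot_pi_eq0 px|G [Gch _ G0 GS]] := chain_cons
  (@incl_inj _ _ (preim_submodule p (K i))) p_surj _ _ Fch.
- by move=> y; apply/quot_pi_eq0; have /preim_submoduleP := inclP y.
- exact/incl_lift/preim_submoduleP.
exists l.+1, G; split=> // -[|k] lt_kl; first by exists i.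
by have [j Fj] := FD k lt_kl; exists j; apply: lmod_iso_trans (GS k) Fj.
Qed.

(** The equality H_t F_k = F_k descends along the filtration, and it forces H_t Delta(j) = Delta(j)
    for the factor at k, so H_t does not annihilate S(j). *)
Lemma filtration_level t M l (F : nat -> submodule M) : (t <= n)%N ->
  (forall x, x \in prod_submodule (H t) (full_submodule M)) ->
  filtration Delta l F ->
  forall k j, (k < l)%N -> lmod_iso (subquotient (F k) (F k.+1)) (Delta j) ->
  (t <= level j)%N.
Proof.
move=> le_tn HM [[F0 Fl Fdec] FD].
have lev k j : {subset F k <= prod_submodule (H t) (F k)} ->
    lmod_iso (subquotient (F k) (F k.+1)) (Delta j) -> (t <= level j)%N.
  move=> HF /subquot_isoP[g g_surj gP]; rewrite leqNgt; apply/negP => lt_jt.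
  have [y y0] := simple_nz (simpleS_simple j); apply: y0.
  have [z <-] := @delta_top_surj _ _ _ K_ker j y; have [u <-] := g_surj z.
  have : u \in prod_submodule (H t) (full_submodule _).
    apply: (prod_incl _ (HF _ (inclP u))) => v /incl_lift[w <-]; by exists w.
  move=> Hu; suff /ker_submoduleP : u \in ker_submodule (top j \o g : {linear _ -> _}) by [].
  move: u Hu; apply: prod_min => h x Hh _; apply/ker_submoduleP.
  by rewrite linearZZ; apply: (level_kills j le_tn).2.
suff HF k : (k < l)%N -> {subset F k <= prod_submodule (H t) (F k)}.
  by move=> k j lt_kl; apply: lev; apply: HF.
elim: k => [|k IH] lt_kl.
  by move=> x _; move: (HM x); apply: prodS.
have {}IH := IH (ltnW lt_kl); have [j Fj] := FD k (ltnW lt_kl).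
have le_tj := lev k j IH Fj.
have /subquot_isoP[g g_surj gP] := Fj; have [Pp _ _] := cover_mapP j.
have [phi phiP] := Pp _ _ g (quot_pi (K j)) g_surj.
pose psi : {linear coverP j -> M} := incl (F k) \o phi.
have psiK q : psi q \in F k.+1 <-> q \in K j.
  by rewrite -quot_pi_eq0 -phiP; split; move/gP.
move=> x Fx; have := IH _ (Fdec k (ltnW lt_kl) x Fx).
(* Here F_k is the sum of psi (P(j)) and F_(k+1). An x in F_(k+1) is thus psi q + z with z in H_t
   F_(k+1) and q in K(j); since K(j) = H_(l(j)+1) K(j) and t <= l(j), psi q is in H_t F_(k+1) as
   well. *)
have : {subset prod_submodule (H t) (F k) <=
    add_submodule (im_submodule psi (full_submodule _)) (prod_submodule (H t) (F k.+1))}.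
  apply: prod_min => h _ Hh /incl_lift[u <-].
  have [q qu] := quot_pi_surj (g u).
  have Fuq : incl (F k) (u - phi q) \in F k.+1.
    by apply/gP; rewrite linearB phiP qu subrr.
  apply/add_submoduleP; exists (psi (h *: q)), (h *: incl (F k) (u - phi q)); split.
  - exact: mem_im.
  - exact: mem_prod.
  - by rewrite linearZZ -scalerDr linearB addrC subrK.
move=> /[apply] /add_submoduleP[_ [z [/im_submoduleP[q _ <-] Hz xE]]].
have Fz : z \in F k.+1 by apply: prod_sub Hz.
rewrite xE rpredD //.
have /psiK Kq : psi q \in F k.+1.
  have -> : psi q = x - z by rewrite xE addrK.
  by rewrite rpredB.
apply: (@prod_map _ _ _ psi (H t) (K j)) => [u /psiK//|].
have := chain_idem (level_lt j) Kq; apply: prodS => //.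
by apply: chain_le; rewrite leqW // level_lt.
Qed.

Lemma chain_strongly_quasi_hereditary : strongly_quasi_hereditary R.
Proof.
exists D, le; split; first exact: le_partial_order.
exists K; split=> [i|i]; first exact: Delta_standard.
split.
- exact: Delta_multiplicity.
- apply: (projective_filtered (m := d)); first exact: K_projective.
  apply: (@bounded_length_inj _ _ _ (incl (K i))) (@cover_bounded i).
  exact: incl_inj.
- move=> j m [l [F [FD <-]]] /eqP; rewrite -lt0n => /card_gt0P[k].
  rewrite inE => /asboolP Fk.
  have lt_ij : (level i < level j)%N.
    (* By idempotence K(i) = H_(l(i)+1) K(i), so all its standard factors have level at least
       l(i)+1. *)
    apply: (filtration_level (t := (level i).+1) (level_lt i) _ FD (ltn_ord k) Fk) => x.
    have Hx := chain_idem (level_lt i) (inclP x).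
    by apply: (prod_incl _ Hx) => v /incl_lift[u <-]; exists u.
  by split; [right | move=> ij; rewrite ij ltnn in lt_ij].
- exact: K_projective.
Qed.

End ChainToStrong.

(** * From standard modules to trace ideals *)

Lemma mem_subst (T : Type) (P : {pred T}) (x y : T) : x = y -> x \in P -> y \in P.
Proof. by move->. Qed.

Section TraceIdeals.
Variables (R : pzRingType) (D : simple_system R).
Implicit Types (i j : idx D) (U : idx D -> Prop).

Definition trace_submodule U : submodule R^o :=
  span_submodule (fun x => exists i (phi : {linear coverP i -> R^o}) p, U i /\ x = phi p).

Lemma mem_trace U i (phi : {linear coverP i -> R^o}) p :
  U i -> phi p \in trace_submodule U.
Proof. by move=> Ui; apply: mem_span; exists i, phi, p. Qed.

Lemma trace_min U (X : submodule R^o) :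
  (forall i (phi : {linear coverP i -> R^o}) p, U i -> phi p \in X) ->
  {subset trace_submodule U <= X}.
Proof. by move=> UX; apply: span_min => _ [i [phi [p [Ui ->]]]]; apply: UX. Qed.

Fact trace_ideal_closed U : ideal_closed (trace_submodule U : {pred R}).
Proof.
split; first exact: (@rpred0 _ (trace_submodule U)).
- by move=> x y Ux Uy; apply: (@rpredD _ (trace_submodule U)).
- by move=> a x Ux; apply: (@rpredZ _ _ (trace_submodule U)).
(* Right multiplication by a is an endomorphism of the left module R, and traces are stable under
   composition with it. *)
move=> a x Ux; apply: (preim_submoduleP (orbit_map (a : R^o)) _ _).
move: x Ux; apply: trace_min => i phi p Ui; apply/preim_submoduleP.
exact: (@mem_trace U i (orbit_map (a : R^o) \o phi : {linear _ -> _}) p).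
Qed.

Definition trace_ideal U : ideal R := Ideal (trace_ideal_closed U).

Lemma trace_not_kills U i : U i -> ~ kills (trace_ideal U) (simpleS i).
Proof.
move=> Ui kU; have [s s0] := simple_nz (simpleS_simple i); apply: s0.
have [Pp c_surj _] := cover_mapP i; have [p <-] := c_surj s.
have [s1 s10] := simple_nz (simpleS_simple i).
have o_surj : surjective_fun (orbit_map s1).
  apply: (@simple_surj _ _ _ (orbit_map s1) 1 (simpleS_simple i)).
  by rewrite orbit_mapE scale1r.
have [phi phiP] := Pp _ _ (orbit_map s1) (cover_map i) o_surj.
by rewrite -phiP orbit_mapE; apply: kU; apply: mem_trace.
Qed.

(** If psi did not vanish at some x in the kernel of P(i) -> S(i), then P(i) would be the sum of
    that kernel and the kernel of psi, and psi would be zero. So psi factors through S(i), and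
    Schur's lemma applies. *)
Lemma cover_hom_simple i j (psi : {linear coverP i -> simpleS j}) p :
  psi p <> 0 -> i = j.
Proof.
move=> pp; have Si := simpleS_simple i; have Sj := simpleS_simple j.
have [_ c_surj csup] := cover_mapP i.
have kerc x : x \in ker_submodule (cover_map i) -> psi x = 0.
  move=> /ker_submoduleP cx; apply: contrapT => px; apply: pp.
  apply/ker_submoduleP; apply: csup => y.
  have [a ya] := simple_gen (psi y) Sj px; exists (a *: x), (y - a *: x); split.
  - by rewrite linearZZ cx scaler0.
  - by apply/ker_submoduleP; rewrite linearB linearZZ ya subrr.
  - by rewrite addrC subrK.
have Qi : lmod_iso (quot_mod (ker_submodule (cover_map i))) (simpleS i).
  by apply/quot_isoP; exists (cover_map i) => // x; split=> /ker_submoduleP.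
apply: (@simpleS_inj _ D); apply: (lmod_iso_trans (lmod_iso_sym Qi)).
apply: (schur (f := quot_lift kerc) (x := quot_pi _ p)) => //.
  exact: simple_iso (lmod_iso_sym Qi) Si.
by rewrite quot_liftE.
Qed.

Lemma trace_kills U i : ~ U i -> kills (trace_ideal U) (simpleS i).
Proof.
move=> nUi h s Uh; suff /ker_submoduleP : h \in ker_submodule (orbit_map s) by [].
move: h Uh; apply: trace_min => j phi p Uj; apply/ker_submoduleP.
apply: contrapT => ps; apply: nUi.
by rewrite -(cover_hom_simple (psi := orbit_map s \o phi : {linear _ -> _}) ps).
Qed.

Lemma trace_prod_cover U i x : U i ->
  x \in prod_submodule (trace_ideal U) (full_submodule (coverP i)).
Proof.
move=> Ui; apply: (prod_cover_full (simpleS_simple i) (cover_mapP i)).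
exact: trace_not_kills.
Qed.

(** For i in U one has P(i) = H P(i), hence phi (P(i)) = H phi (P(i)), which is inside H H. Sums of
    products are indexed by sequences during the induction, for easy concatenation. *)
Lemma trace_idempotent U : idempotent_ideal (trace_ideal U).
Proof.
set H := trace_ideal U.
pose sums (x : R^o) := exists l : seq (R * R),
  (forall k, (k < size l)%N -> (nth (0, 0) l k).1 \in H /\ (nth (0, 0) l k).2 \in H) /\
  x = \sum_(p <- l) p.1 * p.2.
have sums0 : sums 0 by exists [::]; rewrite big_nil.
have sumsZD (a : R) (x y : R^o) : sums x -> sums y -> sums (a *: x + y).
  move=> [l [lH ->]] [m [mH ->]]; exists ([seq (a * p.1, p.2) | p <- l] ++ m); split.
    move=> k; rewrite size_cat size_map nth_cat size_map.
    case: (ltnP k (size l)) => [lt_kl _|le_lk lt_k]; last first.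
      by apply: (mH (k - size l)%N); rewrite ltn_subLR.
    rewrite (nth_map (0, 0)) //; have [H1 H2] := lH k lt_kl; split=> //.
    exact: (@ideal_mull _ H a _ H1).
  rewrite big_cat big_map /= -[_ *: _]/(a * _) mulr_sumr; congr (_ + _).
  by apply: eq_bigr => p _; rewrite mulrA.
move=> x; split=> [Hx|[n [u [v [uv ->]]]]]; last first.
  by apply: rpred_sum => k _; apply: ideal_mull; have [] := uv k.
suff [l [lH ->]] : sums x.
  exists (size l), (fun k => (nth (0, 0) l k).1), (fun k => (nth (0, 0) l k).2).
  by split=> [k|]; [apply: lH | rewrite (big_nth (0, 0)) big_mkord].
suff /(prop_submoduleP sums0 sumsZD x) : x \in prop_submodule sums0 sumsZD by [].
move: x Hx; apply: trace_min => i phi p Ui.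
have : phi p \in prod_submodule H (trace_submodule U).
  apply: (@prod_map _ _ _ phi H (full_submodule (coverP i))); last exact: trace_prod_cover.
  by move=> q _; apply: mem_trace.
move: (phi p); apply: prod_min => h x Hh Hx; apply/prop_submoduleP.
by exists [:: (h, x)]; split=> [[|k]//|]; rewrite big_seq1.
Qed.

End TraceIdeals.

(** * Trace ideals of up-sets for a strongly quasi-hereditary pair *)

Section StrongToChain.
Variables (R : pzRingType) (d : nat) (D : simple_system R) (le : idx D -> idx D -> Prop).
Variable K : forall i : idx D, submodule (coverP i).
Let Delta i : lmodType R := quot_mod (K i).
Hypothesis Rd : bounded_length R^o d.
Hypothesis Kst : forall i, standard_kernel le (K i).
Hypothesis Kmult : forall i, composition_multiplicity (Delta i) (simpleS i) 1.
Hypothesis Kfilt : forall i, filtered Delta (submod_type (K i)).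
Hypothesis Kgt : forall i j m,
  filtration_multiplicity Delta (submod_type (K i)) j m -> m <> 0%N -> le i j /\ i <> j.
Hypothesis Kproj : forall i, projective (submod_type (K i)).
Implicit Types (i j : idx D) (U : idx D -> Prop).

Definition up_closed U := forall i j, U i -> le i j -> U j.

Let tr U := trace_ideal (D := D) U.
Let trM U (M : lmodType R) := prod_submodule (tr U) (full_submodule M).

Let tr_idem U : idem_on (tr U) := idempotent_prod (trace_idempotent U).

Lemma delta_factor i l (F : nat -> submodule (Delta i)) k :
  composition_series l F -> (k < l)%N ->
  exists2 j, le j i & lmod_iso (subquotient (F k) (F k.+1)) (simpleS j).
Proof.
move=> Fc lt_kl; apply: (Kst i).1; exists l, F; split=> //; exists k => //.
exact: lmod_iso_refl.
Qed.

(** Multiplicity one implies Delta(i) <> 0, so K(i) is a proper submodule of P(i). *)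
Lemma K_in_ker i x : x \in K i -> cover_map i x = 0.
Proof.
move=> Kx; apply: contrapT => cx.
have Kfull := cover_full (simpleS_simple i) (cover_mapP i) Kx cx.
have [l [F [[[_ _ Fdec] Fs] Fcount]]] := Kmult i.
have /card_gt0P[k _] : (0 < factor_count l F (simpleS i))%N by rewrite Fcount.
have [[z _]] := (subquot_simpleP (Fdec k (ltn_ord k))).1 (Fs k (ltn_ord k)).
have [y <-] := quot_pi_surj z.
by have -> : quot_pi (K i) y = 0 by [apply/quot_pi_eq0]; rewrite rpred0.
Qed.

Let top := delta_top K_in_ker.

(** The composition factors of Delta(j) are indexed by elements below j, none of which is in the
    up-set U. *)
Lemma trace_kills_delta U j : up_closed U -> ~ U j -> kills (tr U) (Delta j).
Proof.
move=> Uup nUj; have [l [F [Fc _]]] := Kmult j.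
apply: (kills_chain (@tr_idem U) Fc.1) => k h x lt_kl.
have [j' le_j Fj] := delta_factor Fc lt_kl.
move: h x; apply/kills_subquot/(kills_iso (lmod_iso_sym Fj))/trace_kills => Uj'.
exact/nUj/(Uup j').
Qed.

Lemma trace_cover_sub U j : up_closed U -> ~ U j -> {subset trM U (coverP j) <= K j}.
Proof.
move=> Uup nUj; apply: prod_min => h x Hh _; apply/quot_pi_eq0; rewrite linearZZ.
exact: trace_kills_delta Hh.
Qed.

Lemma trace_projective U m Q : up_closed U -> projective Q -> bounded_length Q m ->
  projective (submod_type (trM U Q)).
Proof.
move=> Uup; move: Q; apply: (projective_ind K_in_ker Kproj) => [Q Q0|].
  by apply: projective_zero => x; apply: incl_inj; rewrite raddf0.
move=> Q i p s ps IHker IHK.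
(* For i in U, H_U Q is the direct sum of P(i) and H_U (ker p). *)
case: (EM (U i)) => [Ui|nUi].
  have qker (x : Q) : (idfun \- (s \o p) : {linear Q -> Q}) x \in ker_submodule p.
    by apply/ker_submoduleP; rewrite /= linearB ps subrr.
  have sU x : s x \in trM U Q by apply: prod_map (trace_prod_cover x Ui).
  have iU (x : submod_type (trM U (submod_type (ker_submodule p)))) :
      (incl (ker_submodule p) \o incl _ : {linear _ -> _}) x \in trM U Q.
    exact: prod_map (inclP x).
  have qU (x : submod_type (trM U Q)) :
      (corestr qker \o incl _ : {linear _ -> _}) x
        \in trM U (submod_type (ker_submodule p)).
    exact: prod_map (inclP x).
  apply: (@projective_sum _ _ _ _ (corestr sU) (corestr iU)
    (p \o incl _ : {linear _ -> _}) (corestr qU)) => //; last by have [] := cover_mapP i.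
  by move=> x; apply: incl_inj; rewrite linearD !corestrE /= addrC subrK.
(* For i outside U, idempotence identifies H_U Q with H_U applied to the preimage of K(i). *)
have pK : {subset trM U Q <= preim_submodule p (K i)}.
  move=> x Ux; apply/preim_submoduleP/(trace_cover_sub Uup nUi).
  exact: prod_map Ux.
have pK' (x : submod_type (trM U Q)) : incl _ x \in preim_submodule p (K i).
  exact/pK/inclP.
have aU (x : submod_type (trM U Q)) :
    corestr pK' x \in trM U (submod_type (preim_submodule p (K i))).
  have Hx : incl _ (corestr pK' x) \in prod_submodule (tr U) (trM U Q).
    exact: tr_idem (inclP x).
  by apply: (prod_incl _ Hx) => v /pK/incl_lift[w <-]; exists w.
have bU (x : submod_type (trM U (submod_type (preim_submodule p (K i))))) :
    (incl (preim_submodule p (K i)) \o incl _ : {linear _ -> _}) x \in trM U Q.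
  exact: prod_map (inclP x).
by apply: (@projective_retract _ _ _ (corestr aU) (corestr bU)) IHK => x; apply: incl_inj.
Qed.

Section Step.
Variables (U U' : idx D -> Prop) (i : idx D).
Hypothesis Uup : up_closed U.
Hypothesis U'up : up_closed U'.
Hypothesis nUi : ~ U i.
Hypothesis UU' : forall j, U' j <-> U j \/ j = i.

Let U'i : U' i. Proof. by apply/UU'; right. Qed.

(** The standard factors Delta(j) of K(i) have j > i, so j is in U' and differs from i: it is in U.
    Lifting P(j) -> Delta(j) to F_k shows that F_k is contained in the sum of H_U K(i) and
    F_(k+1). *)
Lemma K_sub_trace : {subset K i <= trM U (coverP i)}.
Proof.
have [l [F [[F0 Fl Fdec] FD]]] := Kfilt i.
suff HF k (x : submod_type (K i)) : (k <= l)%N ->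
    x \in add_submodule (trM U (submod_type (K i))) (F k).
  move=> x /incl_lift[u <-]; apply: prod_map (_ : u \in trM U _) => //.
  have /add_submoduleP[y [z [Uy /Fl-> ->]]] := HF l u (leqnn l).
  by rewrite addr0.
elim: k => [_|k IH lt_kl]; first exact/add_subr/F0.
have /add_submoduleP[y [z [Uy Fz ->]]] := IH (ltnW lt_kl).
have [j Fj] := FD k lt_kl.
have Uj : U j.
  have [] := @Kgt i j (factor_count l F (Delta j)); first by exists l, F.
    apply/eqP; rewrite -lt0n; apply/card_gt0P; exists (Ordinal lt_kl).
    by rewrite inE; apply/asboolP.
  by move=> le_ij ij; case: ((UU' j).1 (U'up U'i le_ij)) => // ji; case: ij.
have /subquot_isoP[g g_surj gP] := Fj; have [Pp _ _] := cover_mapP j.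
have [phi phiP] := Pp _ _ g (quot_pi (K j)) g_surj.
have [u uz] := incl_lift Fz; have [q qu] := quot_pi_surj (g u).
apply/add_submoduleP; exists (y + incl _ (phi q)), (incl _ (u - phi q)); split.
- rewrite rpredD //; apply: (@prod_map _ _ _ (incl (F k) \o phi : {linear _ -> _})
    _ (full_submodule (coverP j))) => //; exact: trace_prod_cover.
- by apply/gP; rewrite linearB phiP qu subrr.
- by rewrite linearB uz addrA [y + _ + z]addrAC addrK.
Qed.

(** In a composition series of Delta(i) the ideal H_U' annihilates every factor except the unique
    S(i). That factor is the top one, and idempotence gives H_U' F_1 = 0, where F_1 is the kernel of
    Delta(i) -> S(i). *)
Lemma trace_rad h x : h \in tr U' -> cover_map i x = 0 -> h *: x \in K i.
Proof.
move=> Hh cx; have [l [F [Fc Fcount]]] := Kmult i; have [[F0 Fl Fdec] Fs] := Fc.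
have /eqP/cards1P[k0 k0P] := Fcount.
have kill k : (k < l)%N -> k <> k0 ->
    forall h x, h \in tr U' -> x \in F k -> h *: x \in F k.+1.
  move=> lt_kl kk0; have [j le_ji Fj] := delta_factor Fc lt_kl.
  apply/kills_subquot/(kills_iso (lmod_iso_sym Fj))/trace_kills => /UU'[Uj|ji].
    exact/nUi/(Uup Uj).
  have : Ordinal lt_kl \in [set k0] by rewrite -k0P inE; apply/asboolP; rewrite ji in Fj.
  by move=> /set1P k0E; apply: kk0; rewrite -k0E.
have lt_0l : (0 < l)%N by apply: leq_ltn_trans (ltn_ord k0).
have [[z _ F1z] F01] := (subquot_simpleP (Fdec 0%N lt_0l)).1 (Fs 0%N lt_0l).
have k00 : k0 = 0%N :> nat.
  (* If the top factor were annihilated, Delta(i) = H_U' Delta(i) would be contained in F_1. *)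
  apply: contrapT => k0n; move: F1z; apply/negP/negPn.
  have [y <-] := quot_pi_surj z; have := trace_prod_cover y U'i.
  move=> Uy; apply/preim_submoduleP; move: y Uy.
  apply: prod_min => h' y Hh' _; apply/preim_submoduleP; rewrite linearZZ.
  by apply: kill => //; move=> k0E; apply: k0n; rewrite -k0E.
have HF1 k : (0 < k <= l)%N -> {subset prod_submodule (tr U') (F 1%N) <= F k}.
  elim: k => // -[_ _ y /prod_sub//|k IH /andP[_ lt_kl]] y /tr_idem.
  apply: prod_min => h' t Hh' Ht; apply: kill => //; first by rewrite k00.
  by apply: IH Ht; rewrite /= ltnW.
apply/quot_pi_eq0; rewrite linearZZ; apply: Fl.
apply: (HF1 l); first by rewrite lt_0l leqnn.
apply: mem_prod => //.
have F1top y : y \in F 1%N -> top i y = 0.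
  move=> Fy; apply: contrapT => /(delta_top_full Fy) F1all.
  by rewrite F1all in F1z.
have [|//|kF|Fk] := F01 (ker_submodule (top i)).
- by move=> y /F1top/ker_submoduleP.
- by apply/kF/ker_submoduleP; rewrite quot_liftE.
have [s s0] := simple_nz (simpleS_simple i); have [t ts] := delta_top_surj K_in_ker s.
by case: s0; rewrite -ts; apply/ker_submoduleP/Fk/F0.
Qed.

(** It suffices to take y = phi p with phi defined on P(i). Then x a y = phi (x (a p)); since a
    annihilates S(i), a p is in the kernel of P(i) -> S(i), so x (a p) is in K(i), hence in H_U
    P(i). *)
Lemma trace_heredity a x y :
  (forall S : lmodType R, simple_module S -> kills (tr U) S ->
     forall s : S, a *: s = 0) ->
  x \in tr U' -> y \in tr U' -> x * a * y \in tr U.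
Proof.
pose rad a := forall S : lmodType R, simple_module S -> kills (tr U) S ->
  forall s : S, a *: s = 0.
move=> rada Hx Hy; move: a x rada Hx.
pose P (y : R^o) := forall a x, rad a -> x \in tr U' -> x * a * y \in tr U.
have P0 : P 0 by move=> a x _ _; rewrite mulr0 rpred0.
have PZD (b : R) (t z : R^o) : P t -> P z -> P (b *: t + z).
  move=> Pt Pz a x rada Hx; rewrite mulrDr -[b *: t]/(b * t) mulrA -(mulrA x a b).
  rewrite rpredD //; [apply: Pt | apply: Pz] => // S Ss kS s.
  by rewrite -scalerA rada.
suff /(prop_submoduleP P0 PZD y) : y \in prop_submodule P0 PZD by [].
move: y Hy; apply: trace_min => j phi p /UU'[Uj|ji]; apply/prop_submoduleP => a x rada Hx.
  by apply: ideal_mull; apply: mem_trace.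
move: phi p; rewrite ji => phi p.
have -> : x * a * phi p = phi (x *: (a *: p)) by rewrite !linearZZ -mulrA.
apply/(prod_regularP (tr U)).
apply: (@prod_map _ _ _ phi _ (full_submodule _)) => //; apply/K_sub_trace/trace_rad => //.
by rewrite linearZZ rada //; [apply: simpleS_simple | apply: trace_kills].
Qed.

(** * The layer H_U' / H_U as a module on the other side *)

Section OppositeBasis.
Variables (f : {linear R^o -> coverP i}) (s : {linear coverP i -> R^o}).
Hypothesis fs : forall x, f (s x) = x.
Let e : R := s (f 1).

Let sf (a : R) : s (f a) = a * e.
Proof. by rewrite (orbit_map_eta f a) linearZZ. Qed.

Let se x : s x * e = s x. Proof. by rewrite -sf fs. Qed.

Let ee : e * e = e. Proof. exact: se. Qed.

Let e_in : e \in tr U'.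
Proof.
apply/(prod_regularP (tr U')); apply: (@prod_map _ _ _ s _ (full_submodule _)) => //.
exact: trace_prod_cover.
Qed.

Let e_notin : e \notin tr U.
Proof.
apply/negP => Ue; have [y y0] := simple_nz (simpleS_simple i); apply: y0.
have [_ c_surj _] := cover_mapP i; have [x <-] := c_surj y.
rewrite -[x]fs -se orbit_map_eta linearZZ -scalerA.
by rewrite (trace_kills nUi (cover_map i (f 1)) Ue) scaler0.
Qed.

(** If b = e a e is not in H_U, then f b is not in the kernel of P(i) -> S(i), by [trace_rad]. So f
    b generates P(i), and f 1 = c (f b) becomes e = c b under s. *)
Lemma corner_left_inverse (a : R) : e * a * e \notin tr U ->
  exists c, e * c * e * (e * a * e) = e.
Proof.
set b := e * a * e => Ub.
have be : b * e = b by rewrite /b -mulrA ee.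
have eb : e * b = b by rewrite /b !mulrA ee.
have cb : cover_map i (f b) <> 0.
  move=> cb; case/negP: Ub; rewrite -eb -be -sf -[e * _]/(e *: s (f b)) -linearZZ.
  apply/(prod_regularP (tr U)); apply: (@prod_map _ _ _ s _ (full_submodule _)) => //.
  exact/K_sub_trace/trace_rad.
have /cyclic_submoduleP[c cE] := cover_full (simpleS_simple i) (cover_mapP i)
  (mem_cyclic (f b)) cb (f 1).
have ecb : e = c * b by rewrite /e cE linearZZ sf be.
by exists c; rewrite -mulrA eb -mulrA -ecb ee.
Qed.

(** The left inverse of e a e is not in H_U either, so it has a left inverse in turn, which must be
    e a e. *)
Lemma corner_right_inverse (a : R) : e * a * e \notin tr U ->
  exists c, e * a * e * (e * c * e) = e.
Proof.
move=> Ua; have [c ca] := corner_left_inverse Ua.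
have [|b bc] := @corner_left_inverse c.
  apply: contra e_notin => Uc; by have := ideal_mulr (e * a * e) Uc; rewrite ca.
have ab : e * a * e = e * b * e.
  have := congr1 (fun t => e * b * e * t) ca.
  by rewrite mulrA bc !mulrA ee -!mulrA ee.
by exists c; rewrite ab.
Qed.

(** As over a division ring, a generating family of least size is free: a relation with a
    coefficient outside H_U could be solved for one generator. *)
Lemma basis_exists m (g : 'I_m -> R) :
  (forall a : R, exists c : 'I_m -> R,
     (forall k b, c k * b = b * c k) /\ a = \sum_k g k * c k) ->
  exists n (x : 'I_n -> R),
    (forall b, exists z : 'I_n -> R, b * e - \sum_k x k * (e * z k * e) \in tr U) /\
    (forall z : 'I_n -> R, \sum_k x k * (e * z k * e) \in tr U ->
       forall k, e * z k * e \in tr U).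
Proof.
move=> gen.
pose P n := `[< exists x : 'I_n -> R, forall b, exists z : 'I_n -> R,
  b * e - \sum_k x k * (e * z k * e) \in tr U >].
have exP : exists n, P n.
  (* The c k are central, so g k (c k) e = g k (e (c k) e). *)
  exists m; apply/asboolP; exists g => b; have [c [cC ->]] := gen b.
  exists c; rewrite mulr_suml -sumrB big1 ?rpred0 // => k _.
  by rewrite -mulrA -(cC k e) -(mulrA (c k)) ee subrr.
have [n /asboolP[x xgen] nmin] := ex_minnP exP.
exists n, x; split=> // z zU t; apply: contraT => Ut.
have [c cP] := corner_right_inverse Ut.
case: n x xgen nmin z zU t Ut cP => [|n] x xgen nmin z zU t Ut cP; first by case: t Ut cP.
suff: P n by move/nmin; rewrite ltnn.
apply/asboolP; exists (fun k => x (lift t k)) => b; have [w wP] := xgen b.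
(* The relation multiplied on the right by c e (w t) e expresses x t (e (w t) e) by the other
   generators modulo H_U, and this replaces the term of index t. *)
exists (fun k => w (lift t k) - z (lift t k) * e * c * e * w t).
have xt : x t * (e * z t * e) * (c * e * w t * e) = x t * (e * w t * e).
  transitivity (x t * (e * z t * e * (e * c * e) * w t * e)); last by rewrite cP.
  by rewrite !mulrA -(mulrA _ e e) ee.
apply: mem_subst (rpredD wP (ideal_mulr (c * e * w t * e) zU)).
rewrite !(bigD1_ord t) //= mulrDl xt -addrA; congr (_ + _).
rewrite opprD addrACA addNr add0r mulr_suml -!sumrN -big_split; apply: eq_bigr => k _ /=.
by rewrite mulrBr mulrBl mulrBr opprB addrC !mulrA.
Qed.

(** For Q = P(i) this is the freeness of the family in R e, transported by s; for Q = P(j) with j in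
    U it is trivial since H_U P(j) = P(j). Induction on projectives extends it to R. *)
Lemma basis_injective n (x : 'I_n -> R) :
  (forall z : 'I_n -> R, \sum_k x k * (e * z k * e) \in tr U ->
     forall k, e * z k * e \in tr U) ->
  forall m Q, projective Q -> bounded_length Q m -> forall z : 'I_n -> Q,
  \sum_k x k *: (e *: z k) \in trM U Q -> forall k, e *: z k \in trM U Q.
Proof.
move=> xfree.
have base j : j = i -> forall y : 'I_n -> coverP j,
    \sum_k x k *: (e *: y k) \in trM U (coverP j) ->
    forall k, e *: y k \in trM U (coverP j).
  move=> -> y yU k.
  have : e * s (y k) * e \in tr U.
    apply: (xfree (fun k => s (y k))); apply/(prod_regularP (tr U)).
    have syU : s (\sum_k x k *: (e *: y k)) \in trM U R^o by apply: prod_map yU.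
    apply: mem_subst syU; rewrite linear_sum; apply: eq_bigr => l _.
    by rewrite !linearZZ -mulrA se.
  rewrite -mulrA se => eyU.
  by rewrite -[e *: y k]fs linearZZ orbit_map_eta; apply: mem_prod.
apply: (projective_ind K_in_ker Kproj) => [Q Q0 z _ k|].
  by rewrite [e *: z k]Q0 rpred0.
move=> Q j p sg psg IHker IHK z zU k.
(* Here Q is the direct sum of the kernel of p and P(j), and the relation is projected to both
   summands. *)
case: (EM (U' j)) => [U'j|nU'j].
  have qker (y : Q) : (idfun \- (sg \o p) : {linear Q -> Q}) y \in ker_submodule p.
    by apply/ker_submoduleP; rewrite /= linearB psg subrr.
  have kU : e *: corestr qker (z k) \in trM U (submod_type (ker_submodule p)).
    apply: (IHker (fun k => corestr qker (z k))).
    have -> : \sum_k x k *: (e *: corestr qker (z k)) =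
        corestr qker (\sum_k x k *: (e *: z k)).
      by rewrite linear_sum; apply: eq_bigr => l _; rewrite !linearZZ.
    exact: prod_map zU.
  have -> : e *: z k = incl _ (e *: corestr qker (z k)) + sg (e *: p (z k)).
    by rewrite !linearZZ corestrE -scalerDr /= subrK.
  rewrite rpredD //; first exact: prod_map kU.
  apply: (@prod_map _ _ _ sg _ (full_submodule _)) => //.
  have pU : \sum_k x k *: (e *: p (z k)) \in trM U (coverP j).
    have -> : \sum_k x k *: (e *: p (z k)) = p (\sum_k x k *: (e *: z k)).
      by rewrite linear_sum; apply: eq_bigr => l _; rewrite !linearZZ.
    exact: prod_map zU.
  case: ((UU' j).1 U'j) => [Uj|ji]; first exact: trace_prod_cover.
  exact: base ji (fun k => p (z k)) pU k.
(* As e is in H_U', the e (z k) lie in H_U' Q, which p maps into K(j). The relation therefore holds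
   in the preimage of K(j). *)
have trK V : up_closed V -> ~ V j -> {subset trM V Q <= preim_submodule p (K j)}.
  move=> Vup nVj y Vy; apply/preim_submoduleP/(trace_cover_sub Vup nVj).
  exact: prod_map Vy.
have eK (y : Q) : exists w, incl (preim_submodule p (K j)) w = e *: y.
  by apply/incl_lift/(trK _ U'up nU'j)/mem_prod.
have [w wP] := choice (fun k => eK (z k)).
have eewP l : incl _ (e *: w l) = e *: z l by rewrite linearZZ wP scalerA ee.
rewrite -eewP; apply: (@prod_map _ _ _ (incl _) _ (full_submodule _)) => //.
apply: IHK.
have Hz : incl _ (\sum_k x k *: (e *: w k)) \in prod_submodule (tr U) (trM U Q).
  apply: tr_idem; apply: mem_subst zU; rewrite linear_sum.
  by apply: eq_bigr => l _; rewrite linearZZ eewP.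
have nUj : ~ U j by move=> Uj; apply: nU'j; apply/UU'; left.
by apply: (prod_incl _ Hz) => v /(trK _ Uup nUj)/incl_lift[u <-]; exists u.
Qed.

(** Modulo H_U the ideal H_U' consists of sums of elements b e c, because phi p = (s p) e phi (f 1)
    for phi defined on P(i). *)
Lemma basis_generates n (x : 'I_n -> R) :
  (forall b, exists z : 'I_n -> R, b * e - \sum_k x k * (e * z k * e) \in tr U) ->
  forall y, y \in tr U' -> exists z : 'I_n -> R, y - \sum_k x k * (e * z k) \in tr U.
Proof.
move=> xgen.
pose P (y : R^o) := exists z : 'I_n -> R, y - \sum_k x k * (e * z k) \in tr U.
have PU (y : R) : y \in tr U -> P y.
  by move=> Uy; exists (fun=> 0); rewrite big1 ?subr0 // => k _; rewrite !mulr0.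
have PD (y z : R) : P y -> P z -> P (y + z).
  move=> [u uP] [v vP]; exists (fun k => u k + v k).
  apply: mem_subst (rpredD uP vP).
  rewrite addrACA -opprD; congr (_ - _); rewrite -big_split; apply: eq_bigr => k _ /=.
  by rewrite !mulrDr.
have Pe (b c : R) : P (b * e * c).
  have [z zP] := xgen b; exists (fun k => z k * e * c).
  apply: mem_subst (ideal_mulr c zP); rewrite mulrBl mulr_suml; congr (_ - _).
  by apply: eq_bigr => k _; rewrite !mulrA.
have P0 : P 0 by apply: PU; rewrite rpred0.
have PZD (a : R) (y z : R^o) : P y -> P z -> P (a *: y + z).
  move=> [u uP] Pz; apply: (PD _ _ _ Pz).
  have -> : a *: y = a * (y - \sum_k x k * (e * u k)) + \sum_k a * x k * e * u k.
    rewrite mulrBr mulr_sumr -[a *: y]/(a * y) -[LHS]addr0 -addrA; congr (_ + _).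
    apply/esym/eqP; rewrite addrC subr_eq0; apply/eqP/eq_bigr => k _.
    by rewrite !mulrA.
  apply: (PD _ _); first exact/PU/ideal_mull.
  by apply: (big_ind P P0 PD) => k _; apply: Pe.
move=> y Hy; suff /(prop_submoduleP P0 PZD y) : y \in prop_submodule P0 PZD by [].
move: y Hy; apply: trace_min => j phi p /UU'[Uj|ji]; apply/prop_submoduleP.
  by apply: PU; apply: mem_trace.
move: phi p; rewrite ji => phi p.
have -> : phi p = s p * e * phi (f 1); last exact: Pe.
by rewrite se -[in LHS](fs p) (orbit_map_eta f (s p)) linearZZ.
Qed.

End OppositeBasis.

(** The generators are replaced by x k e, which lie in H_U'; independence with arbitrary
    coefficients e z is [basis_injective] for Q = R. *)
Lemma trace_opposite_basis m (g : 'I_m -> R) :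
  (forall a : R, exists c : 'I_m -> R,
     (forall k b, c k * b = b * c k) /\ a = \sum_k g k * c k) ->
  exists (e : R) n (x : 'I_n -> R),
    [/\ forall k, x k \in tr U',
        forall y, y \in tr U' -> exists z : 'I_n -> R, y - \sum_k x k * (e * z k) \in tr U
      & forall z : 'I_n -> R, \sum_k x k * (e * z k) \in tr U ->
          forall k, e * z k \in tr U].
Proof.
move=> gen; have [f [s fs]] := cover_split (simpleS_simple i) (cover_mapP i).
pose e : R := s (f 1).
have ee : e * e = e.
  transitivity (s (e *: f 1)); first by rewrite linearZZ.
  by rewrite -(orbit_map_eta f e) fs.
have [n [x [xgen xfree]]] := basis_exists fs gen.
exists e, n, (fun k => x k * e); split.
- move=> k; apply: ideal_mull.
  apply/(prod_regularP (tr U')); apply: (@prod_map _ _ _ s _ (full_submodule _)) => //.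
  exact: trace_prod_cover.
- move=> y /(basis_generates fs xgen)[z zP]; exists z; apply: mem_subst zP; congr (_ - _).
  by apply: eq_bigr => k _; rewrite -(mulrA (x k) e) (mulrA e) ee.
- move=> z zU k; apply/(prod_regularP (tr U)).
  apply: (@basis_injective f s fs n x xfree d R^o (@projective_regular R) Rd z) k.
  apply/(prod_regularP (tr U)); apply: mem_subst zU; apply: eq_bigr => l _.
  by rewrite -mulrA (mulrA e) ee.
Qed.

End Step.

End StrongToChain.

(** * Linear extensions and the chain of trace ideals *)

Section LinearExtension.
Variables (I : Type) (le : I -> I -> Prop).
Hypothesis le_po : partial_order le.

Lemma count_lt (T : Type) (a b : pred T) (s : seq T) :
  subpred a b -> has (predD b a) s -> (count a s < count b s)%N.
Proof.
move=> ab; elim: s => //= x s IH /orP[/andP[nax bx]|/IH lt_ab].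
  by rewrite (negbTE nax) bx add0n add1n ltnS sub_count.
by rewrite -addnS leq_add //; case ax: (a x); rewrite ?(ab x ax).
Qed.

(** The elements are sorted by the number of elements below them, which increases strictly along
    [le]; r is the position. The type [{classic I}] provides decidable equality. *)
Lemma linear_extension l (c : 'I_l -> I) : surjective_fun c ->
  exists n (r : I -> nat), [/\ forall i, (r i < n)%N,
    forall t, (t < n)%N -> exists i, r i = t,
    injective r & forall i j, le i j -> i <> j -> (r i < r j)%N].
Proof.
move=> c_surj; have [le_refl le_anti le_trans] := le_po.
pose s : seq {classic I} := undup [seq (c k : {classic I}) | k <- enum 'I_l].
have sI (i : {classic I}) : i \in s.
  rewrite mem_undup; have [k <-] := c_surj i.
  by apply: (map_f (fun k => c k : {classic I})); rewrite mem_enum.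
pose w (i : {classic I}) := count (fun j : {classic I} => `[< le j i >]) s.
pose leT (i j : {classic I}) := (w i <= w j)%N.
pose t := sort leT s.
have tI (i : {classic I}) : i \in t by rewrite mem_sort.
have t_uniq : uniq t by rewrite sort_uniq undup_uniq.
have t_sorted : sorted leT t by apply: sort_sorted => i j; apply: leq_total.
exists (size t), (fun i => index (i : {classic I}) t); split.
- by move=> i; rewrite index_mem.
- move=> k lt_kt; case: (EM (exists i0 : I, True)) => [[i0 _]|t0]; last first.
    by case: (t) lt_kt => // i0 ? _; case: t0; exists i0.
  exists (nth (i0 : {classic I}) t k); exact: index_uniq.
- move=> i j ij; have := nth_index (i : {classic I}) (tI i).
  by rewrite ij nth_index // => ->.
- move=> i j le_ij ij; rewrite ltnNge; apply/negP => le_ji.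
  have := sorted_leq_nth (leT := leT) (fun x y z => @leq_trans _ _ _) (fun x => leqnn _)
    (i : {classic I}) t_sorted.
  move=> /(_ (index (j : {classic I}) t) (index (i : {classic I}) t)).
  rewrite !inE !index_mem !nth_index // => /(_ (tI _) (tI _) le_ji).
  rewrite /leT leqNgt => /negP; apply; apply: count_lt.
    by move=> k /asboolP le_ki; apply/asboolP; apply: le_trans le_ij.
  apply/hasP; exists (j : {classic I}) => //=; apply/andP; split; last exact/asboolP.
  by apply/asboolPn => le_ji'; apply: ij; apply: le_anti.
Qed.

End LinearExtension.

Lemma simple_system_finite (R : pzRingType) d (D : simple_system R) :
  bounded_length R^o d -> exists l (c : 'I_l -> idx D), surjective_fun c.
Proof.
move=> Rd; have [l [F Fc]] := composition_series_exists Rd; exists l.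
have [c cP] := choice (fun k : 'I_l => simpleS_complete D (Fc.2 k (ltn_ord k))).
exists c => i; have [k lt_kl Fk] := simple_iso_factor Fc (simpleS_simple i).
exists (Ordinal lt_kl); apply: (@simpleS_inj _ D).
exact: lmod_iso_trans (lmod_iso_sym (cP (Ordinal lt_kl))) Fk.
Qed.

(** The coefficients will be images of the ground ring; they are put on the right, where the corner
    ring acts on R e. *)
Definition central_generators (R : pzRingType) m (g : 'I_m -> R) : Prop :=
  forall a : R, exists c : 'I_m -> R,
    (forall k b, c k * b = b * c k) /\ a = \sum_k g k * c k.

(* H / I is the direct sum of the right modules x_k e (R / I), each isomorphic to
   e (R / I). *)
Definition layer_basis (R : pzRingType) (H I : ideal R) : Prop :=
  exists (e : R) n (x : 'I_n -> R),
    [/\ forall k, x k \in H,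
        forall y, y \in H -> exists z : 'I_n -> R, y - \sum_k x k * (e * z k) \in I
      & forall z : 'I_n -> R, \sum_k x k * (e * z k) \in I -> forall k, e * z k \in I].

(** The clauses on each layer give the heredity conditions: the first yields H J H = 0, with J seen
    through simple modules, and the second yields projectivity on the side opposite to that of
    R-modules. *)
Lemma strong_chain (R : pzRingType) d : bounded_length R^o d ->
  strongly_quasi_hereditary R ->
  exists n (H : nat -> ideal R),
    [/\ forall x, x \in H 0%N,
        forall x, x \in H n -> x = 0,
        forall t, (t < n)%N ->
          {subset H t.+1 <= H t} /\ (exists2 x, x \in H t & x \notin H t.+1),
        forall t, idempotent_ideal (H t)
      & forall t, projective (submod_type (ideal_as_left (H t)))] /\
    forall t, (t < n)%N ->
      (forall a x y,
        (forall S : lmodType R, simple_module S -> kills (H t.+1) S ->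
           forall s : S, a *: s = 0) ->
        x \in H t -> y \in H t -> x * a * y \in H t.+1) /\
      (forall m (g : 'I_m -> R), central_generators g -> layer_basis (H t) (H t.+1)).
Proof.
move=> Rd [D [le [le_po [K [Kst Kall]]]]].
have Kmult i : composition_multiplicity (quot_mod (K i)) (simpleS i) 1 by case: (Kall i).
have Kfilt i : filtered (fun i => quot_mod (K i)) (submod_type (K i)) by case: (Kall i).
have Kgt i j m : filtration_multiplicity (fun i => quot_mod (K i)) (submod_type (K i)) j m ->
    m <> 0%N -> le i j /\ i <> j by have [_ _ Kgt _] := Kall i; apply: Kgt.
have Kproj i : projective (submod_type (K i)) by case: (Kall i).
have [l [c c_surj]] := simple_system_finite D Rd.
have [n [r [r_lt r_surj r_inj r_mono]]] := linear_extension le_po c_surj.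
pose U t (i : idx D) := (t <= r i)%N : Prop.
have Uup t : up_closed le (U t).
  move=> i j Ui le_ij; case: (EM (i = j)) => [<-//|ij].
  exact/(leq_trans Ui)/ltnW/r_mono.
have US t : (t < n)%N -> exists i,
    ~ U t.+1 i /\ forall j, U t j <-> U t.+1 j \/ j = i.
  move=> /r_surj[i <-]; exists i; split; first by rewrite /U ltnn.
  move=> j; rewrite /U; split=> [|[/ltnW//|->//]].
  by rewrite leq_eqVlt => /predU1P[/r_inj->|]; [right | left].
exists n, (fun t => trace_ideal (U t)); split; first split.
(* A proper H_0 would be contained in a maximal left ideal V and would annihilate the simple module
   R / V, which is some S(i). *)
- move=> x; apply: contraT => Ux.
  have [V Vmax UV] := exists_maximal (V := trace_submodule (U 0%N)) (w := x : R^o) Rd Ux.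
  have Vs := (quot_simpleP V).2 Vmax; have [i Vi] := simpleS_complete D Vs.
  case: (@trace_not_kills _ _ (U 0%N) i isT); apply: (kills_iso Vi) => h y Hh.
  have [a <-] := quot_pi_surj y; rewrite -linearZZ; apply/quot_pi_eq0/UV.
  by case: (ideal_predP (trace_ideal (U 0%N))) => _ _ _; apply.
- move=> x Hx; apply/(@zero_submoduleP _ R^o x); move: x Hx; apply: trace_min => i phi p.
  by rewrite /U leqNgt r_lt.
- move=> t lt_tn; have [i [nUi UU']] := US t lt_tn; split.
    apply: trace_min => j phi p Uj; apply: mem_trace.
    by apply/UU'; left.
  apply: contrapT => nx; apply: (@trace_not_kills _ _ (U t) i); first by apply/UU'; right.
  move=> h x Hh; apply: (trace_kills nUi); apply: contraT => nHh.
  by case: nx; exists h.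
- by move=> t; apply: trace_idempotent.
- move=> t; have := trace_projective Kst Kmult Kproj (Uup t) (@projective_regular R) Rd.
  by apply: projective_eqmem => x; apply/idP/idP => /prod_regularP.
move=> t lt_tn; have [i [nUi UU']] := US t lt_tn; split.
  move=> a x y; exact: (trace_heredity Kst Kmult Kfilt Kgt (Uup t.+1) (Uup t) nUi UU').
move=> m g gen.
exact: (trace_opposite_basis Rd Kst Kmult Kfilt Kgt Kproj (Uup t.+1) (Uup t) nUi UU' gen).
Qed.

(** * Quotient rings and the Jacobson radical *)

Section QuotientRing.
Variables (A : pzRingType) (I : ideal A).
Local Notation B := (quot_ring I).
Local Notation pi := (\pi_(quot_ring I) : A -> quot_ring I).

Lemma quot_ring_surj (b : B) : exists a, pi a = b.
Proof. by exists (repr b); apply: reprK. Qed.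

Lemma quot_ring_eq (a b : A) : pi a = pi b <-> a - b \in I.
Proof. by rewrite Quotient.idealrBE; split=> [->|/eqP]. Qed.

Lemma quot_ringD (a b : A) : pi (a + b) = pi a + pi b. Proof. by rewrite !piE. Qed.
Lemma quot_ringM (a b : A) : pi (a * b) = pi a * pi b. Proof. by rewrite !piE. Qed.
Lemma quot_ringB (a b : A) : pi (a - b) = pi a - pi b. Proof. by rewrite !piE. Qed.
Lemma quot_ring1 : pi 1 = 1. Proof. by rewrite !piE. Qed.
Lemma quot_ring0 : pi 0 = 0. Proof. by rewrite !piE. Qed.

Lemma quot_ring_eq0 (a : A) : pi a = 0 <-> a \in I.
Proof. by rewrite -quot_ring0 quot_ring_eq subr0. Qed.

Lemma quot_ring_sum (n : nat) (F : 'I_n -> A) : pi (\sum_k F k) = \sum_k pi (F k).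
Proof. exact: (big_morph pi quot_ringD quot_ring0). Qed.

Definition quot_ring_rmorphism : {rmorphism A^c -> B^c} :=
  HB.pack (pi : A^c -> B^c)
    (GRing.isZmodMorphism.Build A^c B^c pi quot_ringB)
    (GRing.isMonoidMorphism.Build A^c B^c pi
       (quot_ring1, fun x y : A^c => quot_ringM y x)).

Section RightIdeals.
Variables (U : submodule A^c^o) (V : submodule B^c^o).

Definition quot_right_pred (y : B^c^o) := exists2 x : A, (x : A^c^o) \in U & pi x = y.
Fact quot_right0 : quot_right_pred 0.
Proof. by exists 0; [apply: (@rpred0 _ U) | apply: quot_ring0]. Qed.
Fact quot_rightP (a : B^c) (x y : B^c^o) :
  quot_right_pred x -> quot_right_pred y -> quot_right_pred (a *: x + y).
Proof.
have [c <-] := quot_ring_surj a.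
move=> [u Uu <-] [v Uv <-]; exists (u * c + v); last by rewrite quot_ringD quot_ringM.
by apply: (@rpredD _ U) => //; apply: (@rpredZ _ _ U c u).
Qed.
Definition quot_right : submodule B^c^o := prop_submodule quot_right0 quot_rightP.
Lemma mem_quot_right (y : B) :
  (y : B^c^o) \in quot_right <-> exists2 x : A, (x : A^c^o) \in U & pi x = y.
Proof. by split=> /(prop_submoduleP quot_right0 quot_rightP (y : B^c^o)). Qed.

Definition lift_right_pred (x : A^c^o) := (pi x : B^c^o) \in V.
Fact lift_right0 : lift_right_pred 0.
Proof. by rewrite /lift_right_pred quot_ring0; apply: (@rpred0 _ V). Qed.
Fact lift_rightP (a : A^c) (x y : A^c^o) :
  lift_right_pred x -> lift_right_pred y -> lift_right_pred (a *: x + y).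
Proof.
rewrite /lift_right_pred => Vx Vy; rewrite quot_ringD quot_ringM.
by apply: (@rpredD _ V) => //; apply: (@rpredZ _ _ V (pi a) (pi x)).
Qed.
Definition lift_right : submodule A^c^o := prop_submodule lift_right0 lift_rightP.
Lemma mem_lift_right (x : A) : (x : A^c^o) \in lift_right <-> (pi x : B^c^o) \in V.
Proof. by split=> /(prop_submoduleP lift_right0 lift_rightP (x : A^c^o)). Qed.

Lemma quot_right_mem (x : A) : {subset I <= (U : {pred A})} ->
  (pi x : B^c^o) \in quot_right -> (x : A^c^o) \in U.
Proof.
move=> IU /mem_quot_right[u Uu /esym/quot_ring_eq/IU xu].
by rewrite -[x](subrK u); apply: (@rpredD _ U).
Qed.

End RightIdeals.

(** Correspondence between the maximal right ideals of A / I and those of A that contain I. *)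
Lemma jacobson_quot (a : A) : jacobson_radical (pi a) <->
  (forall U : submodule A^c^o, maximal_submodule U -> {subset I <= (U : {pred A})} ->
     (a : A^c^o) \in U).
Proof.
split=> [Ja U [[w Uw] Um] IU|Ja V [[w Vw] Vm]].
  apply: (quot_right_mem IU); apply: Ja; split.
    by exists (pi w); apply: contra Uw; apply: quot_right_mem.
  move=> W UW; have [|h|h] := Um (lift_right W).
  - by move=> x Ux; apply/mem_lift_right/UW/mem_quot_right; exists x.
  - left=> y; have [x <-] := quot_ring_surj y; apply/idP/idP => [Wx|]; last exact: UW.
    by apply/mem_quot_right; exists x => //; rewrite -h; apply/mem_lift_right.
  - by right=> y; have [x <-] := quot_ring_surj y; apply/mem_lift_right.
apply/mem_lift_right.
have IV : {subset I <= (lift_right V : {pred A})}.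
  move=> x /quot_ring_eq0 x0; apply/mem_lift_right; rewrite x0.
  exact: (@rpred0 _ V).
apply: Ja => //; split.
  have [x xw] := quot_ring_surj w; exists x; apply/negP => /mem_lift_right.
  by rewrite xw (negbTE Vw).
move=> W VW; have IW : {subset I <= (W : {pred A})} by move=> x /IV/VW.
have [|h|h] := Vm (quot_right W).
- move=> y; have [x <-] := quot_ring_surj y => Vx; apply/mem_quot_right; exists x => //.
  exact/VW/mem_lift_right.
- left=> x; apply/idP/idP => [Wx|]; last exact: VW.
  by apply/mem_lift_right; rewrite -h; apply/mem_quot_right; exists x.
- by right=> x; apply: (quot_right_mem IW); apply: h.
Qed.

End QuotientRing.

(** * Left-right symmetry of the radical modulo an ideal *)

Section JacobsonRadical.
Variables (A : pzRingType) (I : ideal A).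

(** By [jacobson_quot], the class of a lies in the radical of A / I. *)
Let rad (a : A) := forall U : submodule A^c^o, maximal_submodule U ->
  {subset I <= (U : {pred A})} -> (a : A^c^o) \in U.

Lemma rad_kills_right a : rad a -> forall S : lmodType A^c, simple_module S ->
  kills (I : {pred A^c}) S -> forall s : S, (a : A^c) *: s = 0.
Proof.
move=> Ja S Ss kS s; apply: contrapT => as0.
have s0 : s <> 0 by move=> s0; apply: as0; rewrite s0 scaler0.
have o_surj : surjective_fun (orbit_map s).
  by apply: (@simple_surj _ _ _ (orbit_map s) 1 Ss); rewrite orbit_mapE scale1r.
suff /ker_submoduleP : (a : A^c^o) \in ker_submodule (orbit_map s) by [].
apply: Ja => [|x Ix]; last by apply/ker_submoduleP/kS.
apply/quot_simpleP; apply: simple_iso Ss; apply/lmod_iso_sym/quot_isoP.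
by exists (orbit_map s) => // x; split=> /ker_submoduleP.
Qed.

Lemma superfluous_rad_right (N : submodule A^c^o) a :
  superfluous (fun x => x \in N) -> a \in N -> rad a.
Proof.
move=> Nsup Na U [[w Uw] Um] _; apply: contraT => nUa.
case: (Um (add_submodule N U)) => [|h|h]; first exact: add_subr.
  by rewrite -h add_subl in nUa.
have /(_ w) := Nsup U (fun x => add_submoduleP _ _ _ (h x)).
by rewrite (negbTE Uw).
Qed.

(** For U maximal containing I, a annihilates the simple right module A / U, in particular the class
    of b. *)
Lemma rad_mull b a : rad a -> rad (b * a).
Proof.
move=> Ja U Um IU; apply/quot_pi_eq0.
rewrite -[b * a : A^c^o]/((a : A^c) *: (b : A^c^o)) linearZZ.
apply: rad_kills_right => //; first exact/quot_simpleP.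
move=> h y Ih; have [x <-] := quot_pi_surj y; rewrite -linearZZ.
by apply/quot_pi_eq0/IU; apply: ideal_mull.
Qed.

Lemma rad_mulr a b : rad a -> rad (a * b).
Proof. by move=> Ja U Um IU; apply: (@rpredZ _ _ U (b : A^c)); apply: Ja. Qed.

Lemma rad_oppr a : rad a -> rad (- a).
Proof. by move=> Ja; rewrite -mulN1r; apply: rad_mull. Qed.

(** Otherwise the right ideal generated by 1 - j and I lies in a maximal one, which also contains j,
    hence 1. *)
Lemma rad_right_inverse d j : bounded_length A^c^o d -> rad j ->
  exists c, (1 - j) * c - 1 \in I.
Proof.
move=> Ad Jj.
pose P (x : A) := exists c : A, x - (1 - j) * c \in I.
have P0 : P 0 by exists 0; rewrite mulr0 subrr rpred0.
have PZD (a x y : A) : P x -> P y -> P (x * a + y).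
  move=> [u xu] [v yv]; exists (u * a + v).
  apply: mem_subst (rpredD (ideal_mulr a xu) yv).
  by rewrite mulrBl mulrDr mulrA opprD addrACA.
pose X := @prop_submodule A^c A^c^o P P0 PZD.
have XP (x : A) : reflect (P x) ((x : A^c^o) \in X) := prop_submoduleP _ _ _.
suff /XP[c cP] : (1 : A^c^o) \in X.
  by exists c; rewrite -opprB rpredN.
apply: contraT => X1; have [U Um XU] := exists_maximal Ad X1.
have [[w Uw] _] := Um.
have Uj : (j : A^c^o) \in U.
  by apply: Jj => // x Ix; apply/XU/XP; exists 0; rewrite mulr0 subr0.
have U1j : (1 - j : A^c^o) \in U.
  by apply/XU/XP; exists 1; rewrite mulr1 subrr rpred0.
have U1 : ((1 - j + j : A) : A^c^o) \in U by apply: (@rpredD _ U).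
have wE : (1 - j + j) * (w : A) = w by rewrite subrK mul1r.
by case/negP: Uw; apply: (mem_subst wE); apply: (@rpredZ _ _ U (w : A^c) _ U1).
Qed.

(** Modulo I, a right inverse c of 1 - j equals 1 + j c, so c has a right inverse e too. Then e = 1
    - j modulo I, and c is a two-sided inverse. *)
Lemma rad_left_inverse d j : bounded_length A^c^o d -> rad j ->
  exists c, c * (1 - j) - 1 \in I.
Proof.
move=> Ad Jj; have [c cP] := rad_right_inverse Ad Jj.
have [e eP] := rad_right_inverse Ad (rad_oppr (rad_mulr c Jj)).
rewrite opprK in eP; exists c.
have ccP : c - (1 + j * c) \in I.
  by apply: mem_subst cP; rewrite mulrBl mul1r opprD addrAC addrA.
have ce : c * e - 1 \in I.
  by apply: mem_subst (rpredD (ideal_mulr e ccP) eP); rewrite mulrBl addrA subrK.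
have je : 1 - j - e \in I.
  have jce : - ((1 - j) * (c * e - 1)) \in I by rewrite rpredN ideal_mull.
  apply: mem_subst (rpredD jce (ideal_mulr e cP)).
  by move: (1 - j) => u; rewrite mulrBr mulr1 mulrBl mul1r mulrA opprB addrA subrK.
apply: mem_subst (rpredD (ideal_mull c je) ce).
by rewrite mulrBr addrA subrK.
Qed.

(** If a s <> 0 then s = b a s for some b, so 1 - b a annihilates s; but it is left invertible
    modulo I. *)
Lemma rad_kills_left d a : bounded_length A^c^o d -> rad a ->
  forall S : lmodType A, simple_module S -> kills I S -> forall s : S, a *: s = 0.
Proof.
move=> Ad Ja S Ss kS s; apply: contrapT => as0.
have [b sE] := simple_gen s Ss as0.
have [c cP] := rad_left_inverse Ad (rad_mull b Ja).
have := kS _ s cP; rewrite scalerBl scale1r -scalerA scalerBl scale1r -scalerA -sE.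
by rewrite subrr scaler0 sub0r => /eqP; rewrite oppr_eq0 => /eqP s0;
   apply: as0; rewrite s0 scaler0.
Qed.

Lemma superfluous_left_inverse (N : submodule A^o) (y : A) :
  superfluous (fun x => x \in N) -> (y : A^o) \in N -> exists c, c * (1 - y) = 1.
Proof.
move=> Nsup Ny.
have /(_ (1 : A^o)) /cyclic_submoduleP[c cE] :
    forall z, z \in cyclic_submodule (1 - y : A^o).
  apply: Nsup => z; exists (z * y), (z * (1 - y)); split.
  - exact: (@rpredZ _ _ N (z : A)).
  - by apply/cyclic_submoduleP; exists z.
  - by rewrite mulrBr mulr1 addrC subrK.
by exists c; rewrite -[c * _]/(c *: (1 - y : A^o)) -cE.
Qed.

(** If x is outside a maximal right ideal U, then 1 - x a is in U for some a. As a x is in N, 1 - a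
    x is left invertible, and so is its left inverse c, which is thus a two-sided inverse. Then 1 +
    x c a is a right inverse of 1 - x a, and U is everything. *)
Lemma superfluous_rad_left (N : submodule A^o) (x : A) :
  superfluous (fun x => x \in N) -> (x : A^o) \in N -> rad x.
Proof.
move=> Nsup Nx U [[w Uw] Um] _; apply: contraT => nUx.
have Nax b : (b * x : A^o) \in N by apply: (@rpredZ _ _ N (b : A)).
case: (Um (add_submodule U (cyclic_submodule (x : A^c^o)))) => [|h|h].
- exact: add_subl.
- by rewrite -h add_subr ?mem_cyclic in nUx.
have /add_submoduleP[u [_ [Uu /cyclic_submoduleP[a0 ->] uE]]] := h (1 : A^c^o).
pose a : A := a0.
have {uE} uE : u = 1 - x * a :> A by apply/esym/eqP; rewrite subr_eq; apply/eqP.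
have [c cP] := superfluous_left_inverse Nsup (Nax a).
have cE : c = 1 - (- (c * a)) * x.
  by rewrite mulNr opprK -{1}cP mulrBr mulr1 mulrA subrK.
have [c' c'P] := superfluous_left_inverse Nsup (Nax (- (c * a))).
rewrite -cE in c'P.
have cP' : (1 - a * x) * c = 1.
  have <- // : c' = 1 - a * x.
  transitivity (c' * (c * (1 - a * x))); first by rewrite cP mulr1.
  by rewrite mulrA c'P mul1r.
have uinv : (1 - x * a) * (1 + x * c * a) = 1.
  have -> : (1 - x * a) * (1 + x * c * a) = 1 - x * a + x * ((1 - a * x) * c) * a.
    rewrite mulrDr mulr1; congr (_ + _).
    by rewrite mulrBl mul1r mulrBl mul1r mulrBr mulrBl !mulrA.
  by rewrite cP' mulr1 subrK.
have Uxa : ((1 - x * a : A) : A^c^o) \in U by rewrite -uE.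
have wE : (1 - x * a) * ((1 + x * c * a) * (w : A)) = w by rewrite mulrA uinv mul1r.
case/negP: Uw; apply: (mem_subst wE).
exact: (@rpredZ _ _ U ((1 + x * c * a) * (w : A) : A) _ Uxa).
Qed.

End JacobsonRadical.

(** * Heredity of the layers H / I over A / I *)

Section Layers.
Variables (A : pzRingType) (H I : ideal A).
Hypothesis IH : {subset I <= H}.
Local Notation B := (quot_ring I).
Local Notation pi := (\pi_(quot_ring I) : A -> quot_ring I).
Local Notation Hq := (ideal_as_right (quot_ideal H I)).

Lemma quot_idempotent : idempotent_ideal H -> idempotent_ideal (quot_ideal H I).
Proof.
move=> Hi y; split=> [/asboolP[x /Hi[n [u [v [uv ->]]]] <-]|[n [u [v [uv ->]]]]]; last first.
  by apply: rpred_sum => k _; apply: ideal_mull; have [] := uv k.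
exists n, (fun k => pi (u k)), (fun k => pi (v k)); split.
  by move=> k; have [Hu Hv] := uv k; split; apply/asboolP; [exists (u k) | exists (v k)].
by rewrite quot_ring_sum; apply: eq_bigr => k _; rewrite quot_ringM.
Qed.

Lemma quot_heredity_mul :
  (forall a x y, (forall U : submodule A^c^o, maximal_submodule U ->
      {subset I <= (U : {pred A})} -> (a : A^c^o) \in U) ->
    x \in H -> y \in H -> x * a * y \in I) <->
  (forall x j y, x \in quot_ideal H I -> jacobson_radical j -> y \in quot_ideal H I ->
    x * j * y = 0).
Proof.
split=> [HJ _ j _ /asboolP[x Hx <-] Jj /asboolP[y Hy <-]|HJ a x y Ja Hx Hy].
  move: Jj; have [a <-] := quot_ring_surj j => /jacobson_quot Ja.
  by rewrite -!quot_ringM; apply/quot_ring_eq0/HJ.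
apply/quot_ring_eq0; rewrite !quot_ringM; apply: HJ; last by apply/asboolP; exists y.
  by apply/asboolP; exists x.
exact/jacobson_quot.
Qed.

Lemma quot_ideal_lift (y : submod_type Hq) : exists2 x : A, x \in H & pi x = incl _ y.
Proof. by have /asboolP := inclP y. Qed.

Lemma quot_ideal_mem (x : A) : x \in H -> (pi x : B^c^o) \in Hq.
Proof. by move=> Hx; apply/asboolP; exists x. Qed.

(** Lift H -> H / I -> N to psi : H -> M over A. Since I = I I and I annihilates M, psi (u v) = psi
    (u) v = 0 for u, v in I, so psi factors through H / I. *)
Lemma quot_projective : idempotent_ideal I ->
  projective (submod_type (ideal_as_right H)) -> projective (submod_type Hq).
Proof.
move=> Ii Hp M N g f g_surj.
pose rho := quot_ring_rmorphism I.
pose M' : lmodType A^c := restrict_scalars rho M.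
pose N' : lmodType A^c := restrict_scalars rho N.
have gL : linear (g : M' -> N') by move=> a x y; apply: linearP.
pose bar (x : submod_type (ideal_as_right H)) : submod_type Hq :=
  SubmodType (quot_ideal_mem (inclP x)).
have fL : linear (fun x => f (bar x) : N').
  move=> a x y; rewrite -[RHS]linearP; congr (f _); apply: val_inj => /=.
  by rewrite quot_ringD quot_ringM.
have [psi psiP] := Hp M' N' (linear_pack gL) (linear_pack fL) g_surj.
have psiI (x : submod_type (ideal_as_right H)) : (incl _ x : A) \in I -> psi x = 0.
  move=> /Ii[n [u [v [uv xE]]]].
  have uH k : (u k : A^c^o) \in ideal_as_right H by apply: IH; have [] := uv k.
  have -> : x = \sum_k (v k : A^c) *: SubmodType (uH k).
    by apply: incl_inj; rewrite linear_sum xE; apply: eq_bigr => k _; rewrite linearZZ.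
  rewrite linear_sum big1 // => k _; rewrite linearZZ.
  rewrite -[LHS]/(rho (v k) *: (psi _ : M)).
  have -> : rho (v k) = 0 by apply/quot_ring_eq0; have [] := uv k.
  by rewrite scale0r.
have ex_lift y : exists x, bar x = y.
  have [x Hx xy] := quot_ideal_lift y.
  by exists (SubmodType (Hx : (x : A^c^o) \in ideal_as_right H)); apply: val_inj.
have [sec secP] := choice ex_lift.
have bar_eq x x' : bar x = bar x' -> psi x = psi x'.
  move=> /(congr1 (incl Hq))/quot_ring_eq xx'; apply/eqP.
  by rewrite -subr_eq0 -linearB; apply/eqP/psiI; rewrite linearB.
have hL : linear (fun y => psi (sec y) : M).
  move=> b y y'; have [a aE] := quot_ring_surj (b : B).
  have -> : psi (sec (b *: y + y')) = psi ((a : A^c) *: sec y + sec y').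
    apply: bar_eq; rewrite secP -{1}[y]secP -{1}[y']secP; apply: val_inj => /=.
    by rewrite quot_ringD quot_ringM aE.
  by rewrite linearP -aE.
by exists (linear_pack hL) => y; rewrite -[LHS]/(linear_pack gL (psi _)) psiP /= secP.
Qed.

(** Each generator is sent to a preimage of its image in N. The coefficients z are only chosen, but
    independence makes the classes of e z unique, which gives linearity. *)
Lemma basis_projective : layer_basis H I -> projective (submod_type Hq).
Proof.
move=> [e [n [x [Hx gen free]]]] M N g f g_surj.
pose xq k : submod_type Hq := SubmodType (quot_ideal_mem (Hx k)).
have [m mP] := choice (fun k => g_surj (f (xq k))).
have ex_z (y : submod_type Hq) : exists z : 'I_n -> A,
    incl _ y = pi (\sum_k x k * (e * z k)) :> B.
  have [y0 /gen[z zP] <-] := quot_ideal_lift y.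
  by exists z; apply/quot_ring_eq.
have [z zP] := choice ex_z.
have hL : linear (fun y => \sum_k (pi (e * z y k) : B^c) *: m k).
  move=> b y y'; have [a aE] := quot_ring_surj (b : B).
  have zE k : pi (e * z (b *: y + y') k) = pi (e * z y k * a + e * z y' k).
    apply/quot_ring_eq; rewrite -mulrA -mulrDr -mulrBr; move: k.
    apply: (free (fun k => z (b *: y + y') k - (z y k * a + z y' k))).
    apply/quot_ring_eq0.
    have -> : \sum_k x k * (e * (z (b *: y + y') k - (z y k * a + z y' k))) =
        \sum_k x k * (e * z (b *: y + y') k) -
        ((\sum_k x k * (e * z y k)) * a + \sum_k x k * (e * z y' k)).
      rewrite mulr_suml -big_split -sumrB; apply: eq_bigr => k _ /=.
      by rewrite !mulrBr !mulrDr !mulrA.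
    rewrite quot_ringB quot_ringD quot_ringM -!zP aE.
    by rewrite linearP subrr.
  rewrite scaler_sumr -big_split; apply: eq_bigr => k _ /=.
  by rewrite zE quot_ringD quot_ringM scalerDl scalerA aE.
exists (linear_pack hL) => y.
have yE : y = \sum_k (pi (e * z y k) : B^c) *: xq k.
  apply: incl_inj; rewrite linear_sum zP quot_ring_sum; apply: eq_bigr => k _.
  by rewrite linearZZ quot_ringM.
rewrite [in RHS]yE /= !linear_sum; apply: eq_bigr => k _.
by rewrite !linearZZ mP.
Qed.

End Layers.

(** * Opposite rings *)

Fact op_ideal_closed (A : pzRingType) (H : ideal A) :
  ideal_closed (ideal_pred H : {pred A^c}).
Proof.
case: (ideal_predP H) => H0 HD Hl Hr.
by split.
Qed.
Definition op_ideal (A : pzRingType) (H : ideal A) : ideal A^c :=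
  @Ideal A^c (ideal_pred H) (op_ideal_closed H).

Fact unop_ideal_closed (A : pzRingType) (H : ideal A^c) :
  ideal_closed (ideal_pred H : {pred A}).
Proof.
case: (ideal_predP H) => H0 HD Hl Hr.
by split.
Qed.
Definition unop_ideal (A : pzRingType) (H : ideal A^c) : ideal A :=
  @Ideal A (ideal_pred H) (unop_ideal_closed H).

Lemma op_idempotent (A : pzRingType) (H : ideal A) :
  idempotent_ideal H -> idempotent_ideal (op_ideal H).
Proof.
move=> Hi x; split=> [/Hi[n [u [v [uv ->]]]]|[n [u [v [uv xE]]]]].
  by exists n, v, u; split=> // k; have [] := uv k.
by apply/Hi; exists n, v, u; split=> // k; have [] := uv k.
Qed.

Lemma unop_idempotent (A : pzRingType) (H : ideal A^c) :
  idempotent_ideal H -> idempotent_ideal (unop_ideal H).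
Proof.
move=> Hi x; split=> [/Hi[n [u [v [uv ->]]]]|[n [u [v [uv xE]]]]].
  by exists n, v, u; split=> // k; have [] := uv k.
by apply/Hi; exists n, v, u; split=> // k; have [] := uv k.
Qed.

Theorem proposition1p1 (A : pzRingType) (artinA : artin_algebra A) :
  (right_strongly_quasi_hereditary A <->
     exists (n : nat) (H : nat -> ideal A),
       heredity_chain n H /\
       forall i, (i < n)%N -> projective (submod_type (ideal_as_right (H i))))
  /\
  (left_strongly_quasi_hereditary A <->
     exists (n : nat) (H : nat -> ideal A),
       heredity_chain n H /\
       forall i, (i < n)%N -> projective (submod_type (ideal_as_left (H i)))).
Proof.
have [[dl Al] [dr Ar]] := artin_algebra_bounded_length artinA.
split; split.
- move=> /(strong_chain Ar)[n [H [[H0 Hn HS Hi Hp] Hlayer]]].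
  have Hproj t : projective (submod_type (ideal_as_right (unop_ideal (H t)))).
    by apply: projective_eqmem (Hp t) => x.
  exists n, (fun t => unop_ideal (H t)); split=> //; split=> //.
  + by move=> t _; apply/unop_idempotent.
  + move=> t lt_tn; split; first exact/quot_idempotent/unop_idempotent.
      by apply: quot_projective => //; [apply: (HS t lt_tn).1 | apply/unop_idempotent].
    apply/quot_heredity_mul => a x y Ja Hx Hy.
    (* Products in the converse ring are reversed, so x and y exchange their places. *)
    rewrite -mulrA; exact: ((Hlayer t lt_tn).1 a y x (rad_kills_right Ja) Hy Hx).
- move=> [n [H [[H0 Hn HS Hi Hh] Hp]]].
  have [D] := simple_system_exists Ar.
  apply: (@chain_strongly_quasi_hereditary _ dr n (fun t => op_ideal (H t))) => //.
  + by move=> t lt_tn; apply: (HS t lt_tn).1.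
  + by move=> t le_tn; apply/op_idempotent/Hi.
  + by move=> t lt_tn; apply: projective_eqmem (Hp t lt_tn) => x.
  move=> t N lt_tn Nsup x a y Hx Na Hy; have [_ _ HJ] := Hh t lt_tn.
  have := (quot_heredity_mul _ _).2 HJ a y x (superfluous_rad_right Nsup Na) Hy Hx.
  by rewrite -mulrA.
- move=> /(strong_chain Al)[n [H [[H0 Hn HS Hi Hp] Hlayer]]].
  exists n, H; split=> //; split=> //.
  move=> t lt_tn; have [HJ Hbasis] := Hlayer t lt_tn; split.
  + exact/quot_idempotent.
  (* H_t is known to be projective on the left only, so the right projectivity of the layer comes
     from its basis; the generators of A over k have central coefficients. *)
  + have [k [f [_ fC [m [g gA]]]]] := artinA.
    apply: basis_projective; apply: (Hbasis m g) => a; have [c ->] := gA a.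
    by exists (fun k => f (c k)); split=> //; apply: eq_bigr.
  + apply/quot_heredity_mul => a x y Ja; exact/HJ/(rad_kills_left Ar).
- move=> [n [H [[H0 Hn HS Hi Hh] Hp]]].
  have [D] := simple_system_exists Al.
  apply: (@chain_strongly_quasi_hereditary _ dl n H) => //.
  + by move=> t lt_tn; apply: (HS t lt_tn).1.
  move=> t N lt_tn Nsup x a y Hx Na Hy; have [_ _ HJ] := Hh t lt_tn.
  exact: ((quot_heredity_mul _ _).2 HJ a x y (superfluous_rad_left Nsup Na) Hx Hy).
Qed.
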